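(* Assume that for every $x=(x_1,\dots,x_d)\in\mathbb{W}$, with $y=(x_2-x_1,\dots,x_d-x_{d-1})$, $$h^{\uparrow}(x):=1+\mathbb{E}\Big(\sum_{n=1}^{J_1-1}\mathbf{1}\{\overline{Y}_{n-1}-Y_n<y\}\Big)<\infty ,$$ where $J_1=\inf\{n>0:\overline{Y}^k_{n-1}<Y^k_n \text{ for all } k\in[d-1]\}$. For $c>0$ let $N$ be a geometric time with parameter $1-e^{-c}$, independent of $X$. Then for every $x\in\mathbb{W}$, every finite $(\mathcal{F}_n)$-stopping time $T$ and every $\Lambda\in\mathcal{F}_T$, $$\lim_{c\to0^+}\mathbb{P}_x\big(\Lambda,\,T\le N\,\big|\,X_i\in\mathbb{W},\ i\in[N]\big)=\mathbb{P}^{\uparrow}_x(\Lambda,T<\zeta):=\frac{1}{h^{\uparrow}(x)}\,\mathbb{E}^{Q}_x\big(h^{\uparrow}(X_T)\mathbf{1}\{\Lambda,\,T<\zeta\}\big).$$ The limit law $\mathbb{P}^\uparrow_x$ is the law of a Markov chain with transition probabilities $$p^{\uparrow}(w,dz)=\mathbf{1}\{z\in\mathbb{W}\}\frac{h^{\uparrow}(z)}{h^{\uparrow}(w)}\,p(w,dz),\qquad w\in\mathbb{W}.$$ Moreover, it is a probability measure if $\mathbb{E}(\tau)=\infty$ (i.e. $\mathbb{P}^\uparrow_x(n<\zeta)=1$ for all $n\ge 1$), and a (defective) subprobability measure if $\mathbb{E}(\tau)<\infty$ (i.e. $\mathbb{P}^\uparrow_x(n<\zeta)<1$ for all $n\geq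 1$).
   Context: Let $d\ge2$ and let $X=(X^1,\dots,X^d)$ be a random walk on $\mathbb{R}^d$ (i.i.d. increments; the components may be dependent and have different distributions). Under $\mathbb{P}$ (expectation $\mathbb{E}$) it starts at $X_0=0$; under $\mathbb{P}_x$ (expectation $\mathbb{E}_x$) it starts at $x$. $p(w,dz)=\mathbb{P}(X_1+w\in dz)$ is its transition kernel. $\mathcal{F}_n=\sigma(X_1,\dots,X_n)$. $[n]=\{1,\dots,n\}$, with $[0]=\emptyset$. $\mathbb{W}=\{x\in\mathbb{R}^d:x_1<\dots<x_d\}$ is the Weyl chamber. $Y=(Y^1,\dots,Y^{d-1})=(X^2-X^1,\dots,X^d-X^{d-1})$ and $\overline{Y}^k_n=\max\{Y^k_j:0\le j\le n\}$, $\overline{Y}_n=(\overline{Y}^1_n,\dots,\overline{Y}^{d-1}_n)$. An inequality $a<b$ between vectors means strict inequality in every component. Standing assumption: for every $k$, $\mathbb{P}(Y^k_1>0)>0$ and $\mathbb{P}(Y^k_1<0)>0$. $\tau=\min\{n\ge1:X_n\notin\mathbb{W}\}$; $\mathbb{E}(\tau)$ is for the walk started at $0$. A geometric time with parameter $1-e^{-c}$ satisfies $\mathbb{P}(N=n)=e^{-cn}(1-e^{-c})$, $n=0,1,2,\dots$. For $x\in\mathbb{W}$, $Q_x$ (expectation $\mathbb{E}^Q_x$) is the law of $X$ started at $x$ and killed at the first exit from $\mathbb{W}$: writing $\zeta$ for the lifetime, $Q_x(\Lambda,n<\zeta)=\mathbb{P}_x(\Lambda,n<\tau)$ for $\Lambda\in\mathcal{F}_n$;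 likewise $\mathbb{E}^Q_x(h^\uparrow(X_T)\mathbf{1}\{\Lambda,T<\zeta\})=\mathbb{E}_x(h^\uparrow(X_T)\mathbf{1}\{\Lambda,T<\tau\})$. *)

(* Defs.v *)
From HB Require Import structures.
From mathcomp Require Import all_boot all_order all_algebra finmap.
From mathcomp Require Import all_classical all_reals all_analysis.

Set Implicit Arguments.
Unset Strict Implicit.
Unset Printing Implicit Defensive.

Import Order.TTheory GRing.Theory Num.Theory.
Import numFieldNormedType.Exports.

Local Open Scope classical_set_scope.
Local Open Scope ring_scope.

(* Points of R^d are d-tuples, which the library equips with the product
   (that is, Borel) sigma-algebra. *)

Section Vectors.
Context {R : realType}.

Definition gaps d (x : d.-tuple R) : d.-1.-tuple R :=
  [tuple x`_k.+1 - x`_k | k < d.-1].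

Definition vlt n (a b : n.-tuple R) : Prop := forall k, tnth a k < tnth b k.

Definition weyl d : set (d.-tuple R) :=
  [set x | forall k : 'I_d.-1, x`_k < x`_k.+1].

Definition vzero d : d.-tuple R := nseq_tuple d 0.

End Vectors.

Section Times.
Context {R : realType}.

(* A time with values in {0, 1, 2, ...} U {+oo}; None is +oo. *)
Definition etime (t : option nat) : \bar R :=
  if t is Some n then (n%:R)%:E else +oo%E.

(* inf A, equal to +oo when A is empty. *)
Definition first_time (A : set nat) : \bar R :=
  ereal_inf [set (n%:R)%:E | n in A].

End Times.

Section Filtrations.
Context {R : realType} {dO dV : measure_display}.
Context {Om : measurableType dO} {V : measurableType dV}.

(* sigma(Z_1, ..., Z_n): Z_0 is excluded, so n = 0 gives the trivial one. *)
Definition past (Z : nat -> Om -> V) (n : nat) : set (set Om) :=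
  <<s \bigcup_(i in [set i | (0 < i <= n)%N])
        preimage_set_system setT (Z i) measurable >>.

Definition past_oo (Z : nat -> Om -> V) : set (set Om) :=
  <<s \bigcup_n past Z n >>.

Definition stopping_time (F : nat -> set (set Om)) (T : Om -> option nat) :=
  forall n, F n [set w | (etime (T w) <= (n%:R)%:E :> \bar R)%E].

Definition stopped_past (Z : nat -> Om -> V) (T : Om -> option nat) :
    set (set Om) :=
  [set L | past_oo Z L /\
    forall n, past Z n (L `&` [set w | (etime (T w) <= (n%:R)%:E :> \bar R)%E])].

End Filtrations.

Section Probability.
Context {R : realType} {dO dV : measure_display}.
Context {Om : measurableType dO} {V : measurableType dV}.
Variable P : probability Om R.

Definition cond_prob (A B : set Om) : R := fine (P (A `&` B)) / fine (P B).

Definition mutually_independent (xi : nat -> {RV P >-> V}) :=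
  forall (I : {fset nat}) (B : nat -> set V), (forall i, measurable (B i)) ->
    P (\bigcap_(i in [set` I]) (xi i @^-1` B i)) =
    (\prod_(i <- I) P (xi i @^-1` B i))%E.

Definition identically_distributed (xi : nat -> {RV P >-> V}) :=
  forall i B, measurable B -> distribution P (xi i) B = distribution P (xi 0%N) B.

Definition independent_of (N : Om -> nat) (F : set (set Om)) :=
  forall L B, F L -> P (L `&` N @^-1` B) = (P L * P (N @^-1` B))%E.

(* The geometric law with parameter 1 - e^{-c}. *)
Definition geometric_time (c : R) (N : Om -> nat) :=
  forall n : nat,
    P [set w | N w = n] = (expR (- (c * n%:R)) * (1 - expR (- c)))%:E.

End Probability.

(* A process Z with a finite lifetime zeta allowed, described by the
   subprobabilities mu n L = Prob(L, n < zeta), is a Markov chain started at x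
   with (substochastic) transition kernel K:
     Prob(L, Z_{n+1} \in B, n + 1 < zeta) = E(K(Z_n, B) 1{L, n < zeta})
   for every L in the past of Z up to time n. *)
Definition killed_markov_chain {R : realType} {dO dV : measure_display}
    {Om : measurableType dO} {V : measurableType dV} (Z : nat -> Om -> V)
    (mu : nat -> {measure set Om -> \bar R}) (K : R.-spker V ~> V) (x : V) :=
  (forall B, measurable B -> mu 0%N (Z 0%N @^-1` B) = \d_x B) /\
  (forall n L B, past Z n L -> measurable B ->
    mu n.+1 (L `&` Z n.+1 @^-1` B) = (\int[mu n]_(w in L) K (Z n w) B)%E).

Section Walk.
Context {R : realType} {dO : measure_display} {Om : measurableType dO}.
Variables (P : probability Om R) (d : nat) (xi : nat -> {RV P >-> d.-tuple R}).

(* The law of [walk x] under P is the law of X under P_x. *)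
Definition walk (x : d.-tuple R) (n : nat) (w : Om) : d.-tuple R :=
  [tuple tnth x k + \sum_(i < n) tnth (xi i w) k | k < d].

Definition Y (n : nat) (w : Om) : d.-1.-tuple R := gaps (walk (vzero d) n w).

Definition Ymax (n : nat) (w : Om) : d.-1.-tuple R :=
  [tuple \big[Num.max/tnth (Y 0 w) k]_(j < n.+1) tnth (Y j w) k | k < d.-1].

(* Under P_x. *)
Definition exit_time (x : d.-tuple R) (w : Om) : \bar R :=
  first_time [set n | (0 < n)%N /\ ~ weyl (walk x n w)].

Definition J1 (w : Om) : \bar R :=
  first_time [set n | (0 < n)%N /\ vlt (Ymax n.-1 w) (Y n w)].

Definition drawdown (n : nat) (w : Om) : d.-1.-tuple R :=
  [tuple tnth (Ymax n.-1 w) k - tnth (Y n w) k | k < d.-1].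

(* The upper limit J_1 - 1 of the sum is encoded as n < J_1. *)
Definition hup (x : d.-tuple R) : \bar R :=
  (1 + \int[P]_w \sum_(1 <= n <oo)
     (\1_[set w' | ((n%:R)%:E < J1 w')%E /\ vlt (drawdown n w') (gaps x)] w)%:E)%E.

(* P^up_x(L, T < zeta), with the expectation under Q_x written as the
   expectation under P_x restricted to T < tau. The default value of X_T
   is irrelevant: T = +oo is excluded by T < tau. *)
Definition Pup (x : d.-tuple R) (T : Om -> option nat) (L : set Om) : \bar R :=
  (((fine (hup x))^-1)%:E *
   \int[P]_(w in L `&` [set w | etime (T w) < exit_time x w])
      hup (walk x (odflt 0%N (T w)) w))%E.

(* p(w, dz) *)
Definition trans (w : d.-tuple R) : set (d.-tuple R) -> \bar R :=
  pushforward P (walk w 1).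

(* p^up(w, dz) *)
Definition trans_up (w : d.-tuple R) (B : set (d.-tuple R)) : \bar R :=
  (\int[trans w]_(z in B `&` weyl (d := d)) (hup z * ((fine (hup w))^-1)%:E))%E.

(* X_i \in W for all i \in {1, ..., N} *)
Definition stays (x : d.-tuple R) (N : Om -> nat) : set Om :=
  [set w | forall i, (0 < i <= N w)%N -> weyl (walk x i w)].

End Walk.

(* Main.v *)
Require Import Defs.
From HB Require Import structures.
From mathcomp Require Import all_boot all_order all_algebra finmap.
From mathcomp Require Import all_classical all_reals all_analysis.
From mathcomp Require Import measurable_realfun zify ring lra.

Set Implicit Arguments.
Unset Strict Implicit.
Unset Printing Implicit Defensive.

Import Order.TTheory GRing.Theory Num.Theory.
Import numFieldNormedType.Exports.

Local Open Scope classical_set_scope.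
Local Open Scope ring_scope.

(** Write y for the gaps of x, and let a_n(x) = P_x(tau > n). Reversing the
    first n increments turns a_n(x) into the probability that the drawdown of Y
    at time n lies below y. Splitting this event at the first simultaneous strict
    ladder time J_1 yields the renewal equation a = u + f * a, where
    u_n(x) = P(n < J_1, drawdown_n < y), f_k = P(J_1 = k) and h(x) = sum_n u_n(x).
    The Markov property at T transfers it to q_n = P_x(L, T <= n < tau):
    q = b + f * q with sum_n b_n = E_x(h(X_T) 1{L, T < tau}). With s = exp(-c), the
    conditional probability is the quotient of the generating functions
    Q(s) / A(s) = B(s) / U(s), in which the factor 1 - F(s) has cancelled, and it
    tends to sum_n b_n / h(x) as s increases to 1. For T = n and L the whole space
    the same equations give sum_n b_n = h(x) - P(J_1 = oo) sum_(m < n) a_m(x), and at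
    x = 0 they give 1 = (1 - F(s)) sum_n s^n P(tau > n); hence mass is lost exactly
    when P(J_1 = oo) > 0, which is equivalent to E(tau) < oo. *)

(** * Generating functions *)

(** Neither A(s) nor Q(s) need stay bounded as s increases to 1, so numerator and denominator have
    no separate finite limits in general; the renewal equations trade them for U and B, which do
    converge to finite values. This rests on both equations having the same f: after a ladder time
    the drawdown involves only later increments, so f does not depend on the start, and the equation
    for the start X_k can be integrated over the event T = k. All limits in s are monotone. The
    finiteness of sum_n b_n comes from q <= a, which after multiplication by 1 - F(s) becomes B(s)
    <= U(s); superharmonicity of h is thus a by-product. The origin fits into the scheme although
    its gaps vanish: the equation only asks for nonnegative gaps, and there U(s) = 1. Reversal and
    independence concern finitely many increments at a time, hence the passage through tuples: path
    events depend on an initial segment, and laws of tuples are determined by boxes. *)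

Section GeneratingFunctions.
Context {R : realType}.
Local Open Scope ereal_scope.
Implicit Types b q : nat -> \bar R.

Lemma nneseries_geometric (s : R) : (0 <= s < 1)%R ->
  \sum_(n <oo) (s ^+ n)%:E = ((1 - s)^-1)%:E.
Proof.
move=> /andP[s0 s1].
have -> : (fun n => \sum_(0 <= k < n) (s ^+ k)%:E) =
          EFin \o series (geometric 1 s).
  apply/funext => n; rewrite /= /series sumEFin; congr (_%:E).
  by apply: eq_bigr => k _; rewrite /geometric /= mul1r.
rewrite -div1r EFin_lim; last by apply: is_cvg_geometric_series; rewrite ger0_norm.
congr (_%:E); apply/cvg_lim => //.
by apply: cvg_geometric_series; rewrite ger0_norm.
Qed.

Lemma nneseries_mkord q n : (forall k, 0 <= q k) ->
  \sum_(k < n) q k = \sum_(k <oo) if (k < n)%N then q k else 0.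
Proof.
move=> q0; rewrite [RHS](nneseries_split 0 n) ?add0n; last by move=> k _; case: ifP.
rewrite big_mkord eseries0 ?adde0; last by move=> k nk _; rewrite ltnNge nk.
by apply: eq_bigr => k _; rewrite ltn_ord.
Qed.

(** Tonelli for series: padding the inner sums with zeros makes both ranges infinite, and for fixed
    k the index n = k + m is then shifted back to m. *)
Lemma nneseries_antidiagonal (c : nat -> nat -> \bar R) : (forall k m, 0 <= c k m) ->
  \sum_(n <oo) \sum_(k < n.+1) c k (n - k)%N = \sum_(k <oo) \sum_(m <oo) c k m.
Proof.
move=> c0; rewrite (eq_eseriesr (fun n _ => nneseries_mkord n.+1
  (fun k => c0 k (n - k)%N))).
rewrite nneseries_interchange; last by move=> i j; case: ifP.
apply: eq_eseriesr => k _.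
transitivity (\sum_(n <oo | (k <= n)%N) c k (n - k)%N).
  by rewrite [RHS]eseries_mkcond; apply: eq_eseriesr => n _; rewrite ltnS.
rewrite -ereal_series -(@nneseries_addn _ (fun n => c k (n - k)%N))//.
by apply: eq_eseriesr => m _; rewrite addnK.
Qed.

Definition genfun (s : R) q := \sum_(n <oo) (s ^+ n)%:E * q n.

Definition conv (f : nat -> R) q n := \sum_(k < n.+1) (f k)%:E * q (n - k)%N.

Lemma conv_ge0 f q : (forall k, (0 <= f k)%R) -> (forall k, 0 <= q k) ->
  forall n, 0 <= conv f q n.
Proof. by move=> f0 q0 n; apply: sume_ge0 => k _; rewrite mule_ge0 ?lee_fin. Qed.

Lemma genfun_ge0 s q : (0 <= s)%R -> (forall k, 0 <= q k) -> 0 <= genfun s q.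
Proof.
by move=> s0 q0; apply: nneseries_ge0 => n _ _; rewrite mule_ge0 ?lee_fin ?exprn_ge0.
Qed.

Lemma genfun1 q : genfun 1 q = \sum_(n <oo) q n.
Proof. by apply: eq_eseriesr => n _; rewrite expr1n mul1e. Qed.

Lemma le_genfun s q b : (0 <= s)%R -> (forall k, 0 <= q k) ->
  (forall k, q k <= b k) -> genfun s q <= genfun s b.
Proof.
move=> s0 q0 qb; apply: lee_nneseries => n.
  by move=> _ _; rewrite mule_ge0 ?lee_fin ?exprn_ge0.
by move=> _; rewrite lee_wpmul2l ?lee_fin ?exprn_ge0.
Qed.

Lemma le_genfun_l s t q : (0 <= s <= t)%R -> (forall k, 0 <= q k) ->
  genfun s q <= genfun t q.
Proof.
move=> /andP[s0 st] q0; apply: lee_nneseries => n.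
  by move=> _ _; rewrite mule_ge0 ?lee_fin ?exprn_ge0.
by move=> _; rewrite lee_wpmul2r ?lee_fin// lerXn2r// nnegrE// (le_trans s0).
Qed.

Lemma genfunD s q b : (0 <= s)%R -> (forall k, 0 <= q k) -> (forall k, 0 <= b k) ->
  genfun s (fun n => q n + b n) = genfun s q + genfun s b.
Proof.
move=> s0 q0 b0; rewrite /genfun -nneseriesD; first last.
- by move=> n _ _; rewrite mule_ge0 ?lee_fin ?exprn_ge0.
- by move=> n _ _; rewrite mule_ge0 ?lee_fin ?exprn_ge0.
by apply: eq_eseriesr => n _; rewrite ge0_muleDr.
Qed.

Lemma genfun_fin_num s q : (0 <= s < 1)%R -> (forall k, 0 <= q k <= 1) ->
  genfun s q \is a fin_num.
Proof.
move=> s01 q01; have /andP[s0 s1] := s01.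
have q0 k : 0 <= q k by have /andP[] := q01 k.
rewrite ge0_fin_numE ?genfun_ge0//.
apply: (@le_lt_trans _ _ (genfun s (fun=> 1))).
  by apply: le_genfun => // k; have /andP[] := q01 k.
rewrite /genfun; under eq_eseriesr do rewrite mule1.
by rewrite nneseries_geometric// ltry.
Qed.

(** The Cauchy product. Finiteness of [genfun s q] lets it leave the outer sum as a real scalar. *)
Lemma genfun_conv s f q : (0 <= s)%R -> (forall k, (0 <= f k)%R) ->
  (forall k, 0 <= q k) -> genfun s q \is a fin_num ->
  genfun s (conv f q) = genfun s (EFin \o f) * genfun s q.
Proof.
move=> s0 f0 q0 gfin.
have sq0 n : 0 <= (s ^+ n)%:E * q n by rewrite mule_ge0 ?lee_fin ?exprn_ge0.
transitivity (\sum_(n <oo) \sum_(k < n.+1)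
    (s ^+ k * f k)%:E * ((s ^+ (n - k))%:E * q (n - k)%N)).
  apply: eq_eseriesr => n _; rewrite /conv ge0_sume_distrr; last first.
    by move=> k _; rewrite mule_ge0 ?lee_fin.
  apply: eq_bigr => k _; rewrite !muleA; congr (_ * _).
  rewrite -!EFinM; congr (_%:E).
  by rewrite mulrAC -exprD subnKC// -ltnS ltn_ord.
rewrite (nneseries_antidiagonal
  (c := fun k m => (s ^+ k * f k)%:E * ((s ^+ m)%:E * q m))); last first.
  by move=> k m; rewrite mule_ge0// lee_fin mulr_ge0// exprn_ge0.
under eq_eseriesr do rewrite nneseriesZl//.
rewrite -/(genfun s q) -(fineK gfin).
under eq_eseriesr do rewrite muleC.
rewrite nneseriesZl; last by move=> k _; rewrite lee_fin mulr_ge0// exprn_ge0.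
by rewrite muleC; congr (_ * _); apply: eq_eseriesr => k _; rewrite EFinM.
Qed.

(** Abel's theorem for nonnegative terms, including a divergent sum: monotonicity in c turns the
    limit into a supremum, which is then compared with the partial sums of q. *)
Lemma genfun_cvg q : (forall n, 0 <= q n) ->
  genfun (expR (- c)) q @[c --> (0%R : R)^'+] --> \sum_(n <oo) q n.
Proof.
move=> q0; rewrite [X in _ --> X](_ : _ =
    ereal_sup [set genfun (expR (- c)) q | c in `]0%R, +oo[]); last first.
  apply/eqP; rewrite eq_le; apply/andP; split; last first.
    apply: ub_ereal_sup => _ [c c0 <-].
    rewrite /= in_itv/= andbT in c0.
    rewrite -genfun1; apply: le_genfun_l => //.
    by rewrite expR_ge0 -[leRHS]expR0 ler_expR oppr_le0 ltW.
  apply: lime_le; first exact: is_cvg_nneseries.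
  apply: nearW => n.
  (* A truncated sum is continuous in c, so its value at c = 0 is a limit of quantities below the
     supremum. *)
  have : \sum_(0 <= k < n) (expR (- c) ^+ k)%:E * q k @[c --> (0%R : R)^'+] -->
      \sum_(0 <= k < n) q k.
    apply: cvg_nnesum => k _; last first.
      rewrite -[X in _ --> X]mul1e; apply: cvgeM => //.
      - by rewrite /mule_def; case: (q k) => //; rewrite oner_eq0.
      - apply: cvg_EFin => //; first exact: nearW.
        apply: cvg_at_right_filter.
        rewrite -[X in _ --> X](expr1n R k).
        have : (fun c : R => expR (- c) ^+ k)%R @ (0%R : R) -->
            (expR (- 0) ^+ k : R)%R.
          apply: (@continuous_comp _ _ _
            (fun c : R => expR (- c)) (fun x => x ^+ k)%R).
            apply: (@continuous_comp _ _ _ (fun c : R => - c)%R expR).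
              exact: opp_continuous.
            exact: continuous_expR.
          exact: exprn_continuous.
        by rewrite oppr0 expR0.
      - exact: cvg_cst.
    by apply: nearW => c; rewrite mule_ge0// lee_fin exprn_ge0// expR_ge0.
  move=> h; apply: (cvge_le _ h).
  near=> c; apply: (@le_trans _ _ (genfun (expR (- c)) q)).
    apply: nneseries_lim_ge => k _ _.
    by rewrite mule_ge0// lee_fin exprn_ge0// expR_ge0.
  apply: ereal_sup_ubound; exists c => //=.
  by rewrite in_itv/= andbT; near: c; exact: nbhs_right_gt.
apply: nonincreasing_at_right_cvge => // c e _ _ ce.
by apply: le_genfun_l => //; rewrite expR_ge0 ler_expR lerN2.
Unshelve. all: by end_near. Qed.

Lemma expRN_lt1 (c : R) : (0 < c)%R -> (0 <= expR (- c) < 1)%R.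
Proof. by move=> c0; rewrite expR_ge0 expR_lt1 oppr_lt0. Qed.

End GeneratingFunctions.

(** Both sides run over the triangle k + j <= n. *)
Lemma sum_triangle_exchange (R : realType) (g : nat -> nat -> \bar R) n :
  (\sum_(k < n.+1) \sum_(j < (n - k).+1) g k j =
   \sum_(j < n.+1) \sum_(k < (n - j).+1) g k j)%E.
Proof.
have widen (F : nat -> \bar R) k : (\sum_(j < (n - k).+1) F j =
    \sum_(j < n.+1 | (j < (n - k).+1)%N) F j)%E.
  by rewrite (big_ord_widen n.+1)// ltnS leq_subr.
under eq_bigr do rewrite widen.
under [RHS]eq_bigr do rewrite (widen (g^~ _)).
rewrite (exchange_big_dep xpredT)//=; apply: eq_bigr => j _.
by apply: eq_bigl => k; have := ltn_ord j; have := ltn_ord k; lia.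
Qed.

(** * Laws of blocks of increments *)

Section TupleLaws.
Context {R : realType} {dV : measure_display} {V : measurableType dV}.
Local Open Scope ereal_scope.

Definition box m (B : 'I_m -> set V) : set (m.-tuple V) :=
  [set t | forall i, B i (tnth t i)].

Lemma measurable_box m (B : 'I_m -> set V) :
  (forall i, measurable (B i)) -> measurable (box B).
Proof.
move=> mB; rewrite (_ : box B = \bigcap_(i in [set: 'I_m])
  ((fun t => tnth t i) @^-1` B i)); last first.
  by apply/seteqP; split=> t /= tB i; [move=> _|]; exact: tB.
apply: fin_bigcap_measurable => // i _; rewrite -[X in measurable X]setTI.
exact: measurable_tnth.
Qed.

Lemma box_generated m : @measurable _ (m.-tuple V) =
  <<s [set box B | B in [set B : 'I_m -> set V | forall i, measurable (B i)]] >>.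
Proof.
apply/seteqP; split; last first.
  apply: smallest_sub; first exact: sigma_algebra_measurable.
  by move=> _ [B mB <-]; exact: measurable_box.
apply: smallest_sub; first exact: smallest_sigma_algebra.
move=> A; rewrite -bigcup_seq => -[i _ [B mB <-]].
apply: sub_sigma_algebra => /=.
(* A coordinate preimage is a box whose other sides are the whole space. *)
exists (fun j => if j == i then B else setT).
  by move=> j; case: ifP.
apply/seteqP; split=> [t /(_ i)|t [_ tB] j]; first by rewrite eqxx.
by case: eqP => // ->.
Qed.

(** Boxes are stable under intersection and include the whole space, so the pi-lambda uniqueness
    theorem applies to finite measures. *)
Lemma tuple_measure_unique m (m1 m2 : {measure set (m.-tuple V) -> \bar R}) :
  m1 setT < +oo ->
  (forall B : 'I_m -> set V, (forall i, measurable (B i)) ->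
    m1 (box B) = m2 (box B)) ->
  forall A, measurable A -> m1 A = m2 A.
Proof.
move=> m1oo m12 A mA.
apply: (measure_unique _ (fun=> setT) (box_generated m)) => //.
- move=> _ _ [B mB <-] [C mC <-]; exists (fun i => B i `&` C i).
    by move=> i; exact: measurableI.
  apply/seteqP; split=> [t BC|t [tB tC] i]; last by split.
  by split=> i; have [] := BC i.
- move=> _; exists (fun=> setT) => //.
  by apply/seteqP; split.
- by rewrite -[RHS](@bigcup_const _ nat setT setT)//; exists 0%N.
- by move=> _ [B mB <-]; exact: m12.
Qed.

End TupleLaws.

Section ImageMeasure.
Context {R : realType} {d1 d2 : measure_display}.
Context {T1 : measurableType d1} {T2 : measurableType d2}.

(* The library's measure structure on pushforwards takes the measurability of f
   as an argument that unification cannot recover from [pushforward mu f]. *)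
Definition image_measure (mu : {measure set T1 -> \bar R}) (f : T1 -> T2)
    (mf : measurable_fun setT f) : {measure set T2 -> \bar R} :=
  measure_function_pushforward__canonical__measure_function_Measure mu mf.

End ImageMeasure.

Section IndependentBlocks.
Context {R : realType} {dO dV : measure_display}.
Context {Om : measurableType dO} {V : measurableType dV}.
Variables (P : probability Om R) (xi : nat -> {RV P >-> V}).
Hypothesis xi_indep : mutually_independent xi.
Hypothesis xi_ident : identically_distributed xi.
Local Open Scope ereal_scope.

(** The index map is arbitrary so that shifted and reversed blocks of increments are both
    instances. *)
Definition sample m (s : 'I_m -> nat) (w : Om) : m.-tuple V :=
  [tuple xi (s i) w | i < m].

Definition block (a m : nat) (w : Om) : m.-tuple V :=
  sample (fun i : 'I_m => (a + i)%N) w.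

Lemma measurable_sample m (s : 'I_m -> nat) : measurable_fun setT (sample s).
Proof.
apply/measurable_fun_tnthP => i.
rewrite (_ : _ \o _ = xi (s i)); first exact: measurable_funPT.
by apply/funext => w /=; rewrite tnth_mktuple.
Qed.

HB.instance Definition _ m (s : 'I_m -> nat) :=
  isMeasurableFun.Build _ _ _ _ (sample s) (measurable_sample s).
HB.instance Definition _ a m := MeasurableFun.copy (block a m)
  (sample (fun i : 'I_m => (a + i)%N)).

Lemma sample_box m (s : 'I_m -> nat) (B : 'I_m -> set V) : injective s ->
  (forall i, measurable (B i)) ->
  P (sample s @^-1` box B) = \prod_(i < m) P (xi 0%N @^-1` B i).
Proof.
move=> sI mB.
pose I := [fset x in map s (enum 'I_m)]%fset.
(* Independence is stated over index sets, so [C] carries the sides of the box from positions to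
   indices; injectivity of [s] makes this unambiguous. *)
pose C j := if [pick i | s i == j] is Some i then B i else setT.
have CE i : C (s i) = B i.
  by rewrite /C; case: pickP => [j /eqP /sI ->//|/(_ i)]; rewrite eqxx.
have mC j : measurable (C j) by rewrite /C; case: pickP.
transitivity (P (\bigcap_(j in [set` I]) (xi j @^-1` C j))).
  congr (P _); apply/seteqP; split=> w /=.
    move=> wB j /=; rewrite !inE => /mapP[i _ ->] /=.
    by rewrite CE; have := wB i; rewrite tnth_mktuple.
  move=> wC i; rewrite tnth_mktuple -CE; apply: wC => /=.
  by rewrite !inE map_f// mem_enum.
rewrite xi_indep// (perm_big (map s (enum 'I_m))) /=; last first.
  apply: uniq_perm; [exact: fset_uniq | by rewrite map_inj_uniq// enum_uniq|].
  by move=> j; rewrite !inE.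
rewrite big_map big_enum /=; apply: eq_bigr => i _.
by rewrite CE; have := xi_ident (s i) (mB i).
Qed.

(** The exchangeability behind time reversal and time shift: by [sample_box] the probability of a
    box does not see the index map. *)
Lemma sample_law m (s t : 'I_m -> nat) A : injective s -> injective t ->
  measurable A -> P (sample s @^-1` A) = P (sample t @^-1` A).
Proof.
move=> sI tI mA.
apply: (tuple_measure_unique (m1 := image_measure P (measurable_sample s))
  (m2 := image_measure P (measurable_sample t))) => //.
  by rewrite -[ltLHS]/(P (sample s @^-1` setT)) preimage_setT probability_setT ltry.
move=> B mB; rewrite -[LHS]/(P (sample s @^-1` box B)).
by rewrite -[RHS]/(P (sample t @^-1` box B)) !sample_box.
Qed.

Lemma block_law a m A : measurable A ->
  P (block a m @^-1` A) = P (block 0 m @^-1` A).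
Proof.
by move=> mA; apply: sample_law => // i j /addnI /val_inj.
Qed.

(** The product formula is known on pairs of boxes and is extended one factor at a time: with one
    set fixed, both sides are finite measures in the other. *)
Lemma block_independent k m A B : measurable A -> measurable B ->
  P (block 0 k @^-1` A `&` block k m @^-1` B) =
  P (block 0 k @^-1` A) * P (block 0 m @^-1` B).
Proof.
have boxes (C : 'I_k -> set V) (D : 'I_m -> set V) :
    (forall i, measurable (C i)) -> (forall i, measurable (D i)) ->
    P (block 0 k @^-1` box C `&` block k m @^-1` box D) =
    P (block 0 k @^-1` box C) * P (block k m @^-1` box D).
  move=> mC mD.
  (* Two boxes over adjacent blocks form a single box over the first k + m increments. *)
  pose E (i : 'I_(k + m)) := match fintype.split i with inl i => C i | inr j => D j end.
  have EE : block 0 k @^-1` box C `&` block k m @^-1` box D =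
            sample (fun i : 'I_(k + m) => i : nat) @^-1` box E.
    apply/seteqP; split=> [w [/= wC wD] i|w /= wE].
      rewrite tnth_mktuple /E; case: fintype.splitP => j ->.
        by have := wC j; rewrite tnth_mktuple.
      by have := wD j; rewrite tnth_mktuple.
    split=> i /=; rewrite tnth_mktuple.
      have := wE (lshift m i); rewrite tnth_mktuple /E.
      by rewrite -[lshift m i]/(fintype.unsplit (inl i)) fintype.unsplitK.
    have := wE (rshift k i); rewrite tnth_mktuple /E.
    by rewrite -[rshift k i]/(fintype.unsplit (inr i)) fintype.unsplitK.
  rewrite EE sample_box//; last 2 first.
  - exact: val_inj.
  - by move=> i; rewrite /E; case: fintype.splitP.
  rewrite big_split_ord /block !sample_box//; last 2 first.
  - by move=> i j /addnI /val_inj.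
  - by move=> i j /val_inj.
  congr (_ * _); apply: eq_bigr => i _; rewrite /E.
    by rewrite -[lshift m i]/(fintype.unsplit (inl i)) fintype.unsplitK.
  by rewrite -[rshift k i]/(fintype.unsplit (inr i)) fintype.unsplitK.
have mb a n (X : set (n.-tuple V)) : measurable X -> measurable (block a n @^-1` X).
  by move=> mX; rewrite -[X in measurable X]setTI; exact: measurable_sample.
have half A' D : measurable A' -> (forall i, measurable (D i)) ->
    P (block 0 k @^-1` A' `&` block k m @^-1` box D) =
    P (block 0 k @^-1` A') * P (block k m @^-1` box D).
  move=> mA' mD.
  have mW := mb k m _ (measurable_box mD).
  (* The fixed factor becomes a nonnegative real, so that the right-hand side is a scaled
     measure. *)
  pose c := (fine (P (block k m @^-1` box D)))%R.
  have c0 : (0 <= c)%R by exact: fine_ge0.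
  have cE : P (block k m @^-1` box D) = c%:E by rewrite fineK// fin_num_measure.
  rewrite cE muleC.
  apply: (tuple_measure_unique
    (m1 := image_measure (mrestr P mW) (measurable_sample _))
    (m2 := mscale (NngNum c0) (image_measure P (measurable_sample _)))) => //.
    rewrite -[ltLHS]/(P (block 0 k @^-1` setT `&` block k m @^-1` box D)).
    by rewrite preimage_setT setTI ltey_eq fin_num_measure.
  move=> C mC.
  rewrite -[LHS]/(P (block 0 k @^-1` box C `&` block k m @^-1` box D)).
  rewrite -[RHS]/(c%:E * P (block 0 k @^-1` box C)) -cE muleC.
  exact: boxes.
move=> mA mB; rewrite -(block_law k mB).
have mU := mb 0%N k _ mA.
pose c := (fine (P (block 0 k @^-1` A)))%R.
have c0 : (0 <= c)%R by exact: fine_ge0.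
have cE : P (block 0 k @^-1` A) = c%:E by rewrite fineK// fin_num_measure.
rewrite cE setIC.
apply: (tuple_measure_unique
  (m1 := image_measure (mrestr P mU) (measurable_sample _))
  (m2 := mscale (NngNum c0) (image_measure P (measurable_sample _)))) => //.
  rewrite -[ltLHS]/(P (block k m @^-1` setT `&` block 0 k @^-1` A)).
  by rewrite preimage_setT setTI ltey_eq fin_num_measure.
move=> C mC.
rewrite -[LHS]/(P (block k m @^-1` box C `&` block 0 k @^-1` A)).
rewrite -[RHS]/(c%:E * P (block k m @^-1` box C)) -cE setIC.
exact: half.
Qed.

(** The joint law of adjacent blocks is a product measure, so Tonelli applies; the second block is
    replaced by the initial block of an independent copy, which has the same law. *)
Lemma integral_blocks k m (F : k.-tuple V * m.-tuple V -> \bar R) :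
  measurable_fun [set: (k.-tuple V * m.-tuple V)%type] F -> (forall z, 0 <= F z) ->
  \int[P]_w F (block 0 k w, block k m w) =
  \int[P]_w \int[P]_w' F (block 0 k w, block 0 m w').
Proof.
move=> mF F0.
have mJ : measurable_fun setT (fun w => (block 0 k w, block k m w)).
  by apply: measurable_fun_pair; exact: measurable_funPT.
transitivity (\int[image_measure P mJ]_z F z).
  by rewrite ge0_integral_pushforward.
transitivity (\int[distribution P (block 0 k) \x distribution P (block 0 m)]_z F z).
  apply: eq_measure_integral => A mA _.
  apply/esym/product_measure_unique => // B C mB mC.
  rewrite -[LHS]/(P (block 0 k @^-1` B `&` block k m @^-1` C)).
  exact: block_independent.
rewrite fubini_tonelli1// ge0_integral_pushforward//; last 2 first.
- exact: measurable_fun_fubini_tonelli_F.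
- by move=> y _; exact: integral_ge0.
apply: eq_integral => w _; rewrite /fubini_F /= ge0_integral_pushforward//.
exact: measurableT_comp.
Qed.

End IndependentBlocks.

(** * Paths *)

Section Paths.
Context {R : realType} {d : nat}.
Local Notation V := (d.-tuple R).
Implicit Types (x : V) (y : d.-1.-tuple R) (e : nat -> V).

Definition path_walk x e n : V :=
  [tuple tnth x i + \sum_(j < n) tnth (e j) i | i < d].

Definition gap_sum e (k : 'I_d.-1) n : R := \sum_(j < n) tnth (gaps (e j)) k.

Definition shift (a : nat) e (i : nat) : V := e (a + i)%N.

(** Time 0 is left out, as in [exit_time]; this allows a start at the origin. *)
Definition stay x n e := forall i, (0 < i <= n)%N -> weyl (path_walk x e i).

(* For n > 0 this says that the drawdown at time n lies below y. *)
Definition below y n e :=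
  forall i, (i < n)%N -> forall k, gap_sum e k i - gap_sum e k n < tnth y k.

(** A simultaneous strict record of all components of Y. It is phrased through [below] so that, at
    vanishing gaps, a small drawdown is literally a ladder time. At n = 0 [below] is vacuous, hence
    the explicit [0 < n]. *)
Definition ladder n e := (0 < n)%N /\ below (vzero d.-1) n e.

Definition ladder_free n e := forall i, (i <= n)%N -> ~ ladder i e.

Definition first_ladder n e := ladder n e /\ ladder_free n.-1 e.

Lemma path_walk_nth x e n j :
  (path_walk x e n)`_j = x`_j + \sum_(i < n) (e i)`_j.
Proof.
have [jd|dj] := ltnP j d; last first.
  rewrite !nth_default ?size_tuple// add0r big1// => i _.
  by rewrite nth_default ?size_tuple.
rewrite -[j]/(val (Ordinal jd)) -!tnth_nth tnth_mktuple; congr (_ + _).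
by apply: eq_bigr => i _; rewrite -tnth_nth.
Qed.

Lemma gaps_path_walk x e n k :
  tnth (gaps (path_walk x e n)) k = tnth (gaps x) k + gap_sum e k n.
Proof.
rewrite !tnth_mktuple !path_walk_nth opprD addrACA; congr (_ + _).
by rewrite -sumrB; apply: eq_bigr => i _; rewrite tnth_mktuple.
Qed.

Lemma weyl_gaps x : weyl x <-> forall k, 0 < tnth (gaps x) k.
Proof.
by split=> Wx k; have := Wx k; rewrite tnth_mktuple subr_gt0.
Qed.

Lemma gap_sum_shift a e k n :
  gap_sum e k (a + n) = gap_sum e k a + gap_sum (shift a e) k n.
Proof. by rewrite /gap_sum big_split_ord. Qed.

Lemma path_walk_shift x a e n :
  path_walk x e (a + n) = path_walk (path_walk x e a) (shift a e) n.
Proof.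
by apply: eq_from_tnth => i; rewrite !tnth_mktuple big_split_ord/= addrA.
Qed.

Lemma eq_gap_sum e e' n k i : (forall j, (j < n)%N -> e j = e' j) -> (i <= n)%N ->
  gap_sum e k i = gap_sum e' k i.
Proof.
by move=> ee' i_n; apply: eq_bigr => j _; rewrite ee'// (leq_trans _ i_n).
Qed.

Lemma eq_path_walk x e e' n i : (forall j, (j < n)%N -> e j = e' j) -> (i <= n)%N ->
  path_walk x e i = path_walk x e' i.
Proof.
move=> ee' i_n; apply: eq_from_tnth => k; rewrite !tnth_mktuple; congr (_ + _).
by apply: eq_bigr => j _; rewrite ee'// (leq_trans _ i_n).
Qed.

(** Dependence on the first n increments only: this and its analogues below move events between
    infinite paths and tuples. One implication is enough, the assumption being symmetric in e and
    e'. *)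
Lemma stay_local x e e' n : (forall j, (j < n)%N -> e j = e' j) ->
  stay x n e -> stay x n e'.
Proof.
move=> ee' xe i /andP[i0 i_n]; rewrite -(eq_path_walk x ee' i_n).
by apply: xe; rewrite i0.
Qed.

Lemma below_local y e e' n : (forall j, (j < n)%N -> e j = e' j) ->
  below y n e -> below y n e'.
Proof.
move=> ee' ye i i_n k.
by rewrite -!(eq_gap_sum _ ee')//; [exact: ye | exact: ltnW].
Qed.

Lemma ladder_local e e' n : (forall j, (j < n)%N -> e j = e' j) ->
  ladder n e -> ladder n e'.
Proof. by move=> ee' [n0 le]; split=> //; exact: below_local le. Qed.

Lemma ladder_free_local e e' n : (forall j, (j < n)%N -> e j = e' j) ->
  ladder_free n e -> ladder_free n e'.
Proof.
move=> ee' le i i_n lad; apply: (le i i_n); apply: ladder_local lad => j ji.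
by rewrite ee'// (leq_trans ji).
Qed.

Lemma first_ladder_local e e' n : (forall j, (j < n)%N -> e j = e' j) ->
  first_ladder n e -> first_ladder n e'.
Proof.
move=> ee' [le fe]; split; first exact: ladder_local le.
apply: ladder_free_local fe => j jn; apply: ee'.
by rewrite (leq_trans jn)// leq_pred.
Qed.

Lemma stay_add x k m e :
  stay x (k + m) e <-> stay x k e /\ stay (path_walk x e k) m (shift k e).
Proof.
split=> [xs|[xk km] i /andP[i0 ikm]].
  split=> i /andP[i0 ik]; first by apply: xs; lia.
  by rewrite -path_walk_shift; apply: xs; lia.
have [ik|ki] := leqP i k; first by apply: xk; rewrite i0.
by rewrite -(subnKC (ltnW ki)) path_walk_shift; apply: km; lia.
Qed.

(** Read backwards, the rise of Y from time i to time n is the value of the original Y at time n -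
    i. Drawdown below y therefore says 0 < y + Y_(n-i), which is survival at time n - i. *)
Lemma below_reverse x n e :
  below (gaps x) n (fun i => e (n.-1 - i)%N) <-> stay x n e.
Proof.
have rev k i : (i <= n)%N -> gap_sum (fun i => e (n.-1 - i)%N) k n =
    gap_sum (fun i => e (n.-1 - i)%N) k i + gap_sum e k (n - i).
  move=> i_n; rewrite -[X in gap_sum _ _ X = _](subnKC i_n) gap_sum_shift; congr (_ + _).
  rewrite /gap_sum (reindex_inj rev_ord_inj)/=; apply: eq_bigr => j _.
  rewrite /shift; congr (tnth (gaps (e _)) _).
  have := ltn_ord j; lia.
have stayE : stay x n e <-> forall i, (i < n)%N -> forall k,
    0 < tnth (gaps x) k + gap_sum e k (n - i).
  split=> [xe i i_n k|h i /andP[i0 i_n]].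
    have /weyl_gaps/(_ k) : weyl (path_walk x e (n - i)) by apply: xe; lia.
    by rewrite gaps_path_walk.
  apply/weyl_gaps => k; rewrite gaps_path_walk.
  by rewrite -(subKn i_n); apply: h; lia.
rewrite stayE; split=> h i i_n k; have := h i i_n k.
  by rewrite (rev k i (ltnW i_n)); lra.
by rewrite (rev k i (ltnW i_n)); lra.
Qed.

(* All earlier values of Y are dominated by the value at a ladder time, so
   the drawdown after it only depends on the subsequent increments. *)
Lemma below_ladder y k n e : (forall i, 0 <= tnth y i) -> ladder k e ->
  (k <= n)%N -> below y n e <-> below y (n - k) (shift k e).
Proof.
move=> y0 [k0 lk] kn.
have nE i : gap_sum e i n = gap_sum e i k + gap_sum (shift k e) i (n - k).
  by rewrite -gap_sum_shift subnKC.
split=> [h i i_nk j|h i i_n j].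
  have := h (k + i)%N _ j; rewrite gap_sum_shift nE.
  have -> : (k + i < n)%N by lia.
  by move=> /(_ isT); lra.
have [ki|ik] := leqP k i.
  have := h (i - k)%N _ j; rewrite nE -[in gap_sum e j i](subnKC ki) gap_sum_shift.
  have -> : (i - k < n - k)%N by lia.
  by move=> /(_ isT); lra.
have lt0 : gap_sum e j i < gap_sum e j k.
  by have := lk i ik j; rewrite tnth_nseq subr_lt0.
have := y0 j; rewrite nE.
(* For n = k the shifted event is vacuous, and the bound comes from the strict inequality at the
   ladder time and y >= 0. Otherwise index 0 of the shifted event bounds the drawdown from level
   Y_k, which exceeds Y_i. *)
have [->|nk] := eqVneq n k.
  by rewrite subnn /gap_sum big_ord0 -/(gap_sum e j i) -/(gap_sum e j k); lra.
have := h 0%N _ j; have -> : (0 < n - k)%N by lia.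
by move=> /(_ isT); rewrite {1}/gap_sum big_ord0; lra.
Qed.

Lemma first_ladder_uniq e k l : first_ladder k e -> first_ladder l e -> k = l.
Proof.
wlog kl : k l / (k <= l)%N.
  move=> h fk fl; case: (leqP k l) => [kl|/ltnW lk]; first exact: h.
  by apply/esym/h.
move=> [lk _] [_ ll]; apply/eqP; rewrite eqn_leq kl/= leqNgt; apply/negP => ltkl.
by apply: (ll k) => //; lia.
Qed.

Lemma ladder_free_or_first e n :
  ladder_free n e \/ exists2 k, (k <= n)%N & first_ladder k e.
Proof.
have [[k [kn lk]]|nl] := pselect (exists k, (k <= n)%N /\ ladder k e); last first.
  by left=> i i_n li; apply: nl; exists i.
right; elim/ltn_ind: k kn lk => k IH kn lk.
have [fk|] := pselect (ladder_free k.-1 e); first by exists k.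
move=> /existsNP[i /not_implyP[ik /contrapT li]].
have k0 := lk.1; apply: (IH i) => //; lia.
Qed.

End Paths.

(** * Measurability of path events *)

Section MeasurablePaths.
Context {R : realType} {d : nat} {dS : measure_display} {S : measurableType dS}.
Local Notation V := (d.-tuple R).
Variables (X : S -> V) (e : S -> nat -> V).
Hypothesis mX : measurable_fun setT X.
Hypothesis me : forall i, measurable_fun setT (e ^~ i).

Lemma measurable_tnth_comp m (f : S -> m.-tuple R) k :
  measurable_fun setT f -> measurable_fun setT (fun s => tnth (f s) k).
Proof. by move=> /measurable_fun_tnthP; exact. Qed.

Lemma measurable_path_walk n : measurable_fun setT (fun s => path_walk (X s) (e s) n).
Proof.
apply/measurable_fun_tnthP => k.
rewrite (_ : _ \o _ = fun s => tnth (X s) k + \sum_(j < n) tnth (e s j) k).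
  apply: measurable_funD; first exact: measurable_tnth_comp.
  by apply: measurable_sum => j; exact: measurable_tnth_comp.
by apply/funext => s /=; rewrite tnth_mktuple.
Qed.

Lemma measurable_gaps (f : S -> V) k : measurable_fun setT f ->
  measurable_fun setT (fun s => tnth (gaps (f s)) k).
Proof.
move=> mf.
have kd : (k.+1 < d)%N by have := ltn_ord k; lia.
rewrite (_ : (fun s => _) =
    fun s => tnth (f s) (Ordinal kd) - tnth (f s) (Ordinal (ltnW kd))).
  by apply: measurable_funB; exact: measurable_tnth_comp.
by apply/funext => s; rewrite tnth_mktuple !(tnth_nth 0).
Qed.

Lemma measurable_gap_sum k n : measurable_fun setT (fun s => gap_sum (e s) k n).
Proof. by apply: measurable_sum => j; exact: measurable_gaps. Qed.

Lemma measurable_forall (D : set nat) (A : nat -> set S) :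
  (forall i, D i -> measurable (A i)) ->
  measurable [set s | forall i, D i -> A i s].
Proof. exact: bigcap_measurableType. Qed.

Lemma measurable_forall_fin (I : finType) (A : I -> set S) :
  (forall i, measurable (A i)) -> measurable [set s | forall i, A i s].
Proof.
move=> mA; rewrite (_ : [set s | _] = \bigcap_(i in setT) A i).
  exact: fin_bigcap_measurable.
by apply/seteqP; split=> s /= h i; [move=> _|]; exact: h.
Qed.

Lemma measurable_set_lt (f g : S -> R) : measurable_fun setT f ->
  measurable_fun setT g -> measurable [set s | f s < g s].
Proof.
move=> mf mg; have := measurable_fun_ltr mf mg measurableT (Y := [set true]) I.
by rewrite setTI; congr measurable; apply/seteqP; split.
Qed.

Lemma measurable_weyl (f : S -> V) : measurable_fun setT f ->
  measurable [set s | weyl (f s)].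
Proof.
move=> mf; rewrite (_ : [set s | _] = [set s | forall k, 0 < tnth (gaps (f s)) k]).
  apply: measurable_forall_fin => k.
  by apply: measurable_set_lt => //; exact: measurable_gaps.
by apply/seteqP; split=> s /weyl_gaps.
Qed.

Lemma measurable_stay n : measurable [set s | stay (X s) n (e s)].
Proof.
apply: (measurable_forall (D := [set i | (0 < i <= n)%N])
  (A := fun i => [set s | weyl (path_walk (X s) (e s) i)])).
by move=> i _; exact/measurable_weyl/measurable_path_walk.
Qed.

Lemma measurable_below (y : S -> d.-1.-tuple R) n : measurable_fun setT y ->
  measurable [set s | below (y s) n (e s)].
Proof.
move=> my; apply: (measurable_forall (D := [set i | (i < n)%N])
  (A := fun i => [set s | forall k,
    gap_sum (e s) k i - gap_sum (e s) k n < tnth (y s) k])).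
move=> i _; apply: measurable_forall_fin => k; apply: measurable_set_lt.
  by apply: measurable_funB; exact: measurable_gap_sum.
exact: measurable_tnth_comp.
Qed.

Lemma measurable_ladder n : measurable [set s | ladder n (e s)].
Proof.
case: n => [|n].
  by rewrite (_ : [set s | _] = set0)//; apply/seteqP; split=> s // -[].
rewrite (_ : [set s | _] = [set s | below (vzero d.-1) n.+1 (e s)]).
  exact: (@measurable_below (fun=> vzero d.-1)).
by apply/seteqP; split=> s; [case | split].
Qed.

Lemma measurable_ladder_free n : measurable [set s | ladder_free n (e s)].
Proof.
apply: (measurable_forall (D := [set i | (i <= n)%N])
  (A := fun i => [set s | ~ ladder i (e s)])).
by move=> i _; exact/measurableC/measurable_ladder.
Qed.

Lemma measurable_first_ladder n : measurable [set s | first_ladder n (e s)].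
Proof.
exact: measurableI (measurable_ladder n) (measurable_ladder_free n.-1).
Qed.

Lemma measurable_below_gaps n : measurable [set s | below (gaps (X s)) n (e s)].
Proof.
apply: measurable_below; apply/measurable_fun_tnthP => k.
exact: measurable_gaps.
Qed.

End MeasurablePaths.

(** * Events of the walk *)

Section FirstTime.
Local Open Scope ereal_scope.

(** The pathwise form of E(tau) = sum_n P(tau > n): the n-th term is the indicator that the first
    time exceeds n. An empty [A] gives +oo on both sides. *)
Lemma first_time_series {R : realType} (A : set nat) :
  first_time A = \sum_(n <oo)
    (if `[< forall m, (m <= n)%N -> ~ A m >] then 1 else 0) :> \bar R.
Proof.
have [[k [Ak kmin]]|nA] := pselect (exists k, A k /\ forall m, (m < k)%N -> ~ A m).
  transitivity (\sum_(n <oo) if (n < k)%N then 1 else 0 : \bar R); last first.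
    apply: eq_eseriesr => n _; congr (if _ then _ else _).
    apply/idP/asboolP => [nk m mn|h]; first by apply: kmin; exact: leq_ltn_trans nk.
    by rewrite ltnNge; apply/negP => kn; exact: (h k).
  rewrite -(nneseries_mkord (q := fun=> 1))// sumEFin sumr_const card_ord.
  apply/eqP; rewrite eq_le; apply/andP; split.
    by apply: ereal_inf_lbound; exists k.
  apply: le_ereal_inf_tmp => _ [m Am <-]; rewrite lee_fin ler_nat leqNgt.
  by apply/negP => /kmin.
have A0 m : ~ A m.
  by elim/ltn_ind: m => m IH Am; apply: nA; exists m.
rewrite (_ : first_time A = +oo); last first.
  rewrite /first_time (_ : [set _ | _ in A] = set0) ?ereal_inf0//.
  by apply/seteqP; split=> // t [m /A0].
rewrite (eq_eseriesr (g := fun=> 1)); last first.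
  by move=> n _; rewrite ifT//; apply/asboolP => m _; exact: A0.
apply/esym/cvg_lim => //.
rewrite (_ : (fun n => _) = fun n => (n%:R)%:E); first exact/cvgenyP.
by apply/funext => n; rewrite big_mkord sumEFin sumr_const card_ord.
Qed.

End FirstTime.

Section WalkEvents.
Context {R : realType} {dO : measure_display} {Om : measurableType dO}.
Variables (P : probability Om R) (d : nat) (xi : nat -> {RV P >-> d.-tuple R}).
Local Notation V := (d.-tuple R).

Definition steps (w : Om) (i : nat) : V := xi i w.

Lemma walk_steps x n w : walk xi x n w = path_walk x (steps w) n.
Proof. by []. Qed.

Lemma Y_steps n w k : tnth (Y xi n w) k = gap_sum (steps w) k n.
Proof.
rewrite /Y walk_steps gaps_path_walk tnth_mktuple.
by rewrite !nth_nseq !if_same subrr add0r.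
Qed.

Lemma Ymax_lt n w k z : (0 < n)%N ->
  tnth (Ymax xi n.-1 w) k < z <->
  (forall j, (j < n)%N -> gap_sum (steps w) k j < z).
Proof.
move=> n0; rewrite tnth_mktuple prednK//; split.
  move=> /bigmax_ltP[_ h] j jn.
  by have := h (Ordinal jn) isT; rewrite Y_steps.
move=> h; apply/bigmax_ltP; split=> [|j _]; rewrite Y_steps; exact: h.
Qed.

Lemma drawdown_below n w y : (0 < n)%N ->
  vlt (drawdown xi n w) y <-> below y n (steps w).
Proof.
move=> n0; split=> [h i i_n k|h k].
  have := h k; rewrite tnth_mktuple ltrBlDr => /(Ymax_lt _ _ _ n0)/(_ i i_n).
  by rewrite Y_steps -ltrBlDr.
rewrite tnth_mktuple ltrBlDr; apply/Ymax_lt => // j jn.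
by rewrite Y_steps -ltrBlDr; exact: h.
Qed.

Lemma ladder_Ymax n w :
  (0 < n)%N /\ vlt (Ymax xi n.-1 w) (Y xi n w) <-> ladder n (steps w).
Proof.
split=> -[n0 h]; split=> //; last first.
  move=> k; apply/Ymax_lt => // i i_n.
  by have := h i i_n k; rewrite Y_steps tnth_nseq subr_lt0.
move=> i i_n k.
by have /(Ymax_lt _ _ _ n0)/(_ i i_n) := h k; rewrite Y_steps tnth_nseq subr_lt0.
Qed.

Lemma lt_first_time (A : set nat) n :
  ((n%:R)%:E < first_time A :> \bar R)%E <-> (forall m, (m <= n)%N -> ~ A m).
Proof.
split=> [nA m mn Am|nA].
  have : (first_time A <= (m%:R : R)%:E)%E by apply: ereal_inf_lbound; exists m.
  by rewrite leNgt => /negP; apply; apply: le_lt_trans nA; rewrite lee_fin ler_nat.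
apply: (@lt_le_trans _ _ (n.+1%:R%:E)); first by rewrite lte_fin ltr_nat.
apply: le_ereal_inf_tmp => _ [m Am <-]; rewrite lee_fin ler_nat ltnNge.
by apply/negP => /nA.
Qed.

Lemma lt_exit_time x n w :
  (etime (Some n) < exit_time xi x w)%E <-> stay x n (steps w).
Proof.
rewrite lt_first_time; split=> h i.
  by move=> /andP[i0 i_n]; apply: contrapT => nW; apply: (h i i_n).
by move=> i_n [i0]; apply; apply: h; rewrite i0.
Qed.

Lemma lt_J1 n w : ((n%:R)%:E < J1 xi w)%E <-> ladder_free n (steps w).
Proof.
rewrite lt_first_time; split=> h i i_n.
  by move=> /ladder_Ymax; exact: h.
by move=> /ladder_Ymax; exact: h.
Qed.

Lemma etime_lt_exit_time x T w : (etime T < exit_time xi x w)%E ->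
  exists2 n, T = Some n & stay x n (steps w).
Proof.
case: T => [n|]; last by rewrite ltNge leey.
by move=> /lt_exit_time; exists n.
Qed.

End WalkEvents.

(** * Events determined by the first n increments *)

Section Prefix.
Context {R : realType} {dO : measure_display} {Om : measurableType dO}.
Variables (P : probability Om R) (d : nat) (xi : nat -> {RV P >-> d.-tuple R}).
Local Notation V := (d.-tuple R).
Local Notation steps := (steps xi).

Definition tuple_path n (t : n.-tuple V) (i : nat) : V := nth (vzero d) t i.

Lemma tuple_path_block a n w i : (i < n)%N ->
  tuple_path (block xi a n w) i = steps w (a + i)%N.
Proof.
move=> i_n.
by rewrite /tuple_path -[i]/(val (Ordinal i_n)) -tnth_nth tnth_mktuple.
Qed.

Lemma measurable_tuple_path n i : measurable_fun setT (@tuple_path n ^~ i).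
Proof.
have [i_n|n_i] := ltnP i n.
  rewrite (_ : _ ^~ _ = fun t => tnth t (Ordinal i_n)); first exact: measurable_tnth.
  by apply/funext => t; rewrite (tnth_nth (vzero d)).
rewrite (_ : _ ^~ _ = fun=> vzero d)//.
by apply/funext => t; rewrite /tuple_path nth_default// size_tuple.
Qed.

Lemma measurable_steps i : measurable_fun setT (steps ^~ i).
Proof. exact: measurable_funPT. Qed.

(** Preimages under one block rather than a generated sigma-algebra: each event comes with a
    measurable set of tuples, to which [integral_blocks] applies. *)
Definition prefix n : set (set Om) :=
  preimage_set_system setT (block xi 0 n) measurable.

Lemma prefix_local n (Q : (nat -> V) -> Prop) :
  (forall e e', (forall i, (i < n)%N -> e i = e' i) -> Q e -> Q e') ->
  measurable [set t : n.-tuple V | Q (tuple_path t)] ->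
  prefix n [set w | Q (steps w)].
Proof.
move=> lQ mQ; exists [set t : n.-tuple V | Q (tuple_path t)] => //.
rewrite setTI; apply/seteqP; split=> w /=; apply: lQ => i i_n.
  by rewrite tuple_path_block.
by rewrite tuple_path_block.
Qed.

Lemma sigma_algebra_prefix n : sigma_algebra setT (prefix n).
Proof. exact: sigma_algebra_preimage (@sigma_algebra_measurable _ _). Qed.

Lemma prefix_measurable n E : prefix n E -> measurable E.
Proof.
by move=> [A mA <-]; exact: measurable_sample.
Qed.

Lemma prefixI n E F : prefix n E -> prefix n F -> prefix n (E `&` F).
Proof.
move=> [A mA <-] [B mB <-]; exists (A `&` B); first exact: measurableI.
by rewrite preimage_setI !setTI.
Qed.

Lemma prefixD n E F : prefix n E -> prefix n F -> prefix n (E `\` F).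
Proof.
move=> [A mA <-] [B mB <-]; exists (A `\` B); first exact: measurableD.
by rewrite !setTI.
Qed.

Lemma prefix_stay x n : prefix n [set w | stay x n (steps w)].
Proof.
apply: prefix_local => [e e'|]; first exact: stay_local.
by apply: (measurable_stay (X := fun=> x)) => // i; exact: measurable_tuple_path.
Qed.

Lemma prefixS m n : (m <= n)%N -> prefix m `<=` prefix n.
Proof.
move=> mn _ [A mA <-].
rewrite setTI (_ : _ @^-1` _ = [set w | A [tuple steps w i | i < m]]); last first.
  by apply/seteqP; split=> w; rewrite /= /block /sample.
apply: (@prefix_local n (fun e => A [tuple e i | i < m])).
  move=> e e' ee' Ae.
  rewrite (_ : [tuple _ | _ < _] = [tuple e i | i < m])//.
  apply: eq_from_tnth => i; rewrite !tnth_mktuple ee'//.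
  by rewrite (leq_trans _ mn).
rewrite -[X in measurable X]setTI.
have : measurable_fun setT
    (fun t : n.-tuple V => [tuple tuple_path t i | i < m] : m.-tuple V).
  apply/measurable_fun_tnthP => i.
  rewrite (_ : _ \o _ = @tuple_path n ^~ i); first exact: measurable_tuple_path.
  by apply/funext => t /=; rewrite tnth_mktuple.
by apply.
Qed.

Lemma past_prefix x n : past (walk xi x) n `<=` prefix n.
Proof.
apply: smallest_sub; first exact: sigma_algebra_prefix.
move=> _ [i /= /andP[i0 i_n] [B mB <-]]; rewrite setTI.
apply: (@prefix_local n (fun e => B (path_walk x e i))).
  by move=> e e' ee'; rewrite (eq_path_walk x ee' i_n).
rewrite -[X in measurable X]setTI.
by apply: measurable_path_walk => // j; exact: measurable_tuple_path.
Qed.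

Lemma past_measurable x n E : past (walk xi x) n E -> measurable E.
Proof. by move=> /past_prefix; exact: prefix_measurable. Qed.

Lemma past_stay x n : past (walk xi x) n [set w | stay x n (steps w)].
Proof.
rewrite (_ : [set w | _] = \bigcap_(i in [set i | (0 < i <= n)%N])
  (walk xi x i @^-1` weyl (d := d)))//.
rewrite -[X in past _ _ X]setCK setC_bigcap /past; apply: sigma_algebraC.
rewrite [X in _ X]bigcup_mkcond; apply: sigma_algebra_bigcup => i.
case: ifPn => [|_]; last exact: sigma_algebra0.
rewrite inE => i_n; apply: sigma_algebraC; apply: sub_sigma_algebra.
exists i => //; exists (weyl (d := d)); last by rewrite setTI.
exact: (@measurable_weyl _ _ _ _ id).
Qed.

Lemma pastI x n A B : past (walk xi x) n A -> past (walk xi x) n B ->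
  past (walk xi x) n (A `&` B).
Proof.
move=> pA pB; rewrite -[A]setCK -[B]setCK -setCU -bigcup2E /past.
apply: sigma_algebraC; apply: sigma_algebra_bigcup => -[|[|i]] /=.
- exact: sigma_algebraC.
- exact: sigma_algebraC.
- exact: sigma_algebra0.
Qed.

(** Walks with different starts are translates of each other. This is what makes N, assumed
    independent of the walk from 0, independent of the walk from x. *)
Lemma past_start x z n : past (walk xi x) n `<=` past (walk xi z) n.
Proof.
apply: smallest_sub; first exact: smallest_sigma_algebra.
move=> _ [i i_n [B mB <-]]; apply: sub_sigma_algebra; exists i => //.
pose f (v : V) : V := [tuple tnth v k + (tnth x k - tnth z k) | k < d].
exists (f @^-1` B).
  rewrite -[X in measurable X]setTI.
  have : measurable_fun setT f.
    apply/measurable_fun_tnthP => k.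
    rewrite (_ : _ \o _ = fun v => tnth v k + (tnth x k - tnth z k)).
      by apply: measurable_funD => //; exact: measurable_tnth.
    by apply/funext => v /=; rewrite tnth_mktuple.
  by apply.
rewrite !setTI; apply/seteqP; split=> w /=;
  by rewrite (_ : f (walk xi z i w) = walk xi x i w)//;
     apply: eq_from_tnth => k; rewrite !tnth_mktuple; ring.
Qed.

Lemma past_past_oo x z n : past (walk xi x) n `<=` past_oo (walk xi z).
Proof.
move=> A /(past_start (z := z)) zA.
by apply: sub_sigma_algebra; exists n.
Qed.

End Prefix.

(** * Exit probabilities *)

Section WalkProbabilities.
Context {R : realType} {dO : measure_display} {Om : measurableType dO}.
Variables (P : probability Om R) (d : nat) (xi : nat -> {RV P >-> d.-tuple R}).
Hypothesis xi_indep : mutually_independent xi.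
Hypothesis xi_ident : identically_distributed xi.
Local Notation V := (d.-tuple R).
Local Notation steps := (steps xi).
Local Open Scope ereal_scope.

(* [pstay], [pfree] and [pfirst] are the sequences a, u and f. *)
Definition pstay n x := P [set w | stay x n (steps w)].

Definition pfree n x :=
  P [set w | ladder_free n (steps w) /\ below (gaps x) n (steps w)].

Definition pfirst n := fine (P [set w | first_ladder n (steps w)]).

Lemma measurable_Om_stay x n : measurable [set w | stay x n (steps w)].
Proof. by apply: (measurable_stay (X := fun=> x)) => //; exact: measurable_steps. Qed.

Lemma measurable_Om_below y n : measurable [set w | below y n (steps w)].
Proof. by apply: (measurable_below _ (y := fun=> y)) => //; exact: measurable_steps. Qed.

Lemma measurable_Om_ladder_free n : measurable [set w | ladder_free n (steps w)].
Proof. by apply: measurable_ladder_free; exact: measurable_steps. Qed.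

Lemma measurable_Om_first_ladder n : measurable [set w | first_ladder n (steps w)].
Proof. by apply: measurable_first_ladder; exact: measurable_steps. Qed.

Lemma pfirstE n : (pfirst n)%:E = P [set w | first_ladder n (steps w)].
Proof. by rewrite fineK// fin_num_measure//; exact: measurable_Om_first_ladder. Qed.

Lemma pfirst_ge0 n : (0 <= pfirst n)%R.
Proof. exact: fine_ge0. Qed.

Lemma pfirst0 : pfirst 0 = 0%R.
Proof.
rewrite /pfirst (_ : [set w | _] = set0) ?measure0//.
by apply/seteqP; split=> w // -[[]].
Qed.

Lemma pstay0 x : pstay 0 x = 1.
Proof.
rewrite /pstay (_ : [set w | _] = setT) ?probability_setT//.
by apply/seteqP; split=> w // _ [].
Qed.

Lemma pfree0 x : pfree 0 x = 1.
Proof.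
rewrite /pfree (_ : [set w | _] = setT) ?probability_setT//.
apply/seteqP; split=> w // _; split=> // i.
by rewrite leqn0 => /eqP -> [].
Qed.

Lemma pstay01 n x : 0 <= pstay n x <= 1.
Proof. by rewrite measure_ge0 probability_le1//; exact: measurable_Om_stay. Qed.

Lemma pfree_ge0 n x : 0 <= pfree n x.
Proof. exact: measure_ge0. Qed.

(** Time reversal: reversed increments are a sample along the injective map [t], hence have the same
    law as the increments in their order. *)
Lemma pstay_below n x : pstay n x = P [set w | below (gaps x) n (steps w)].
Proof.
pose A := [set t : n.-tuple V | below (gaps x) n (tuple_path t)].
have mA : measurable A.
  by apply: (measurable_below _ (y := fun=> gaps x)) => // i; exact: measurable_tuple_path.
pose s (i : 'I_n) := (i : nat); pose t (i : 'I_n) := (n.-1 - i)%N.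
have sI : injective s by exact: val_inj.
have tI : injective t.
  by move=> i j; rewrite /t => /eqP ij; apply/val_inj => /=; have := ltn_ord i;
    have := ltn_ord j; lia.
transitivity (P (sample xi t @^-1` A)).
  congr (P _); apply/seteqP; split=> w /=.
    move=> /below_reverse; apply: below_local => i i_n.
    by rewrite /tuple_path -[i]/(val (Ordinal i_n)) -tnth_nth tnth_mktuple.
  move=> wA; apply/below_reverse; apply: below_local wA => i i_n.
  by rewrite /tuple_path -[i]/(val (Ordinal i_n)) -tnth_nth tnth_mktuple.
rewrite (sample_law xi_indep xi_ident tI sI mA).
congr (P _); apply/seteqP; split=> w /=; apply: below_local => i i_n;
  by rewrite /tuple_path -[i]/(val (Ordinal i_n)) -tnth_nth tnth_mktuple.
Qed.

Lemma first_ladder_below k m y :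
  P [set w | first_ladder k (steps w) /\ below y m (shift k (steps w))] =
  (pfirst k)%:E * P [set w | below y m (steps w)].
Proof.
pose A := [set t : k.-tuple V | first_ladder k (tuple_path t)].
pose B := [set t : m.-tuple V | below y m (tuple_path t)].
have mA : measurable A.
  by apply: measurable_first_ladder => i; exact: measurable_tuple_path.
have mB : measurable B.
  by apply: (measurable_below _ (y := fun=> y)) => // i; exact: measurable_tuple_path.
have AE : block xi 0 k @^-1` A = [set w | first_ladder k (steps w)].
  apply/seteqP; split=> w /=; apply: first_ladder_local => i ik;
    by rewrite tuple_path_block.
have BE a : block xi a m @^-1` B = [set w | below y m (shift a (steps w))].
  apply/seteqP; split=> w /=; apply: below_local => i im;
    by rewrite tuple_path_block.
have := block_independent xi_indep xi_ident mA mB.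
by rewrite AE !BE pfirstE => <-.
Qed.

Lemma first_ladder_trivIset (D : set nat) (F : nat -> set Om) :
  (forall k, F k `<=` [set w | first_ladder k (steps w)]) -> trivIset D F.
Proof.
move=> FF i j _ _ [w [/FF iw /FF jw]].
exact: first_ladder_uniq iw jw.
Qed.

(** The drawdown event is split at the first ladder time. Gaps may vanish, so that the equation also
    holds for the start at the origin, where it governs E(tau). *)
Lemma pstay_renewal n x : (forall k, (0 <= tnth (gaps x) k)%R) ->
  pstay n x = pfree n x + conv pfirst (pstay ^~ x) n.
Proof.
move=> x0; rewrite pstay_below.
set B := [set w | _].
pose F k := B `&` [set w | first_ladder k (steps w)].
have mF k : measurable (F k).
  by apply: measurableI; [exact: measurable_Om_below|exact: measurable_Om_first_ladder].
have BE : B = [set w | ladder_free n (steps w) /\ below (gaps x) n (steps w)] `|`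
    \big[setU/set0]_(k < n.+1) F k.
  rewrite -bigcup_mkord; apply/seteqP; split=> [w Bw|w [[]//|[k _ []//]]].
  have [fr|[k kn fk]] := ladder_free_or_first (steps w) n; first by left.
  by right; exists k.
rewrite [in LHS]BE measureU; first last.
- rewrite -bigcup_mkord; apply/seteqP; split=> // w [[fr _] [k kn [_ [lk _]]]].
  exact: (fr k).
- by apply: bigsetU_measurable => k _.
- exact: measurableI (measurable_Om_ladder_free n) (measurable_Om_below _ n).
congr (_ + _); rewrite measure_bigsetU//; last first.
  by apply: first_ladder_trivIset => k w [].
apply: eq_bigr => k _; rewrite pstay_below -first_ladder_below; congr (P _).
have kn : (k <= n)%N by rewrite -ltnS ltn_ord.
apply/seteqP; split=> [w [Bw fk]|w [fk Bw]]; split=> //.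
  exact/(below_ladder x0 fk.1 kn).
exact/(below_ladder x0 fk.1 kn).
Qed.

Lemma sum_pfirst_le1 : \sum_(k <oo) (pfirst k)%:E <= 1.
Proof.
rewrite (eq_eseriesr (fun k _ => pfirstE k)).
have mF k : measurable [set w | first_ladder k (steps w)].
  exact: measurable_Om_first_ladder.
rewrite -measure_semi_bigcup//; last 2 first.
- by apply: first_ladder_trivIset => k w.
- exact: bigcup_measurable.
by apply: probability_le1; exact: bigcup_measurable.
Qed.

(** The start is treated as an extra coordinate; the probability of a section of a measurable set
    depends measurably on it. *)
Lemma measurable_pstay n : measurable_fun setT (pstay n).
Proof.
pose B := [set z : V * Om | stay z.1 n (steps z.2)].
have mB : measurable B.
  apply: measurable_stay => // i.
  exact: measurableT_comp (measurable_steps xi i) measurable_snd.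
have := measurable_fun_xsection P mB.
congr measurable_fun; apply/funext => x /=; congr (P _).
by apply/seteqP; split=> w; rewrite /xsection /= inE.
Qed.

Lemma measurable_pfree n : measurable_fun setT (pfree n).
Proof.
pose B := [set z : V * Om | ladder_free n (steps z.2) /\
                            below (gaps z.1) n (steps z.2)].
have ms i : measurable_fun setT (fun z : V * Om => steps z.2 i).
  exact: measurableT_comp (measurable_steps xi i) measurable_snd.
have mB : measurable B.
  apply: measurableI; first exact: measurable_ladder_free.
  exact: measurable_below_gaps.
have := measurable_fun_xsection P mB.
congr measurable_fun; apply/funext => x /=; congr (P _).
by apply/seteqP; split=> w; rewrite /xsection /= inE.
Qed.

Lemma measurable_walk x n : measurable_fun setT (walk xi x n).
Proof.
exact: (measurable_path_walk (measurable_cst x) (measurable_steps xi)).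
Qed.

(** The Markov property at time k: [E] and X_k are functions of the first block and the rest of the
    second, so [G] depends on two adjacent blocks. *)
Lemma walk_markov x k m (E : set Om) (F : V * m.-tuple V -> \bar R) :
  prefix xi k E -> measurable_fun setT F -> (forall z, 0 <= F z) ->
  \int[P]_(w in E) F (walk xi x k w, block xi k m w) =
  \int[P]_(w in E) \int[P]_w' F (walk xi x k w, block xi 0 m w').
Proof.
move=> [A mA <-] mF F0; rewrite setTI.
pose G (u : k.-tuple V * m.-tuple V) : \bar R :=
  (\1_A u.1)%:E * F (path_walk x (tuple_path u.1) k, u.2).
have GE a w w' : G (block xi 0 k w, block xi a m w') =
    if w \in block xi 0 k @^-1` A then F (walk xi x k w, block xi a m w') else 0.
  rewrite /G /= indicE walk_steps.
  rewrite (@eq_path_walk _ _ x _ (steps w) k)//; last first.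
    by move=> j jk; rewrite tuple_path_block.
  rewrite (_ : (w \in _) = (block xi 0 k w \in A)); last by apply/idP/idP; rewrite !inE.
  by case: ifP => _; rewrite ?mul1e ?mul0e.
have mG : measurable_fun setT G.
  apply: emeasurable_funM.
    apply/measurable_EFinP; apply: measurableT_comp; last exact: measurable_fst.
    exact: measurable_indic.
  apply: measurableT_comp => //; apply: measurable_fun_pair => //.
  apply: (measurable_path_walk (measurable_cst x)) => i.
  exact: measurableT_comp (measurable_tuple_path i) measurable_fst.
have G0 z : 0 <= G z by rewrite mule_ge0// lee_fin.
rewrite integral_mkcond [RHS]integral_mkcond.
transitivity (\int[P]_w G (block xi 0 k w, block xi k m w)).
  by apply: eq_integral => w _; rewrite GE patchE.
rewrite integral_blocks//; apply: eq_integral => w _; rewrite patchE.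
under eq_integral do rewrite GE.
by case: ifP => // _; rewrite integral0.
Qed.

(** As [E] already forces survival up to k, only survival for m further steps from X_k remains. *)
Lemma prefix_stay_split x k m (E : set Om) :
  prefix xi k E -> E `<=` [set w | stay x k (steps w)] ->
  P (E `&` [set w | stay x (k + m) (steps w)]) =
  \int[P]_(w in E) pstay m (walk xi x k w).
Proof.
move=> pE Ek; pose B := [set z : V * m.-tuple V | stay z.1 m (tuple_path z.2)].
have mB : measurable B.
  apply: measurable_stay => // i.
  exact: measurableT_comp (measurable_tuple_path i) measurable_snd.
have BE a z w : B (z, block xi a m w) <-> stay z m (shift a (steps w)).
  by split; apply: stay_local => i im; rewrite tuple_path_block.
have mBa a (f : Om -> V) : measurable_fun setT f ->
    measurable [set w | B (f w, block xi a m w)].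
  move=> mf; rewrite -[X in measurable X]setTI.
  have : measurable_fun setT (fun w => (f w, block xi a m w)).
    by apply: measurable_fun_pair => //; exact: measurable_funPT.
  exact.
have mE := prefix_measurable pE.
transitivity (\int[P]_(w in E) (\1_B (walk xi x k w, block xi k m w))%:E).
  transitivity (\int[P]_(w in E) (\1_[set w | B (walk xi x k w, block xi k m w)] w)%:E);
    last exact: eq_integral.
  rewrite integral_indic//; last exact/mBa/measurable_walk.
  congr (P _); apply/seteqP; split=> w /= [].
    by move=> Ew /stay_add[_ h]; split=> //; apply/BE.
  by move=> /BE h Ew; split=> //; apply/stay_add; split=> //; exact: Ek.
rewrite (@walk_markov x k m E (fun z => (\1_B z)%:E))//; last first.
  by apply/measurable_EFinP; exact: measurable_indic.
apply: eq_integral => w _.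
transitivity (\int[P]_w' (\1_[set w' | B (walk xi x k w, block xi 0 m w')] w')%:E).
  exact: eq_integral.
rewrite integral_indic//; last exact: mBa.
rewrite setIT; congr (P _); apply/seteqP; split=> w' /=.
  by move=> /(BE 0%N).
by move=> h; apply/(BE 0%N).
Qed.

End WalkProbabilities.

(** * The renewal function *)

Section RenewalFunction.
Context {R : realType} {dO : measure_display} {Om : measurableType dO}.
Variables (P : probability Om R) (d : nat) (xi : nat -> {RV P >-> d.-tuple R}).
Hypothesis xi_indep : mutually_independent xi.
Hypothesis xi_ident : identically_distributed xi.
Local Notation V := (d.-tuple R).
Local Notation pstay := (pstay xi).
Local Notation pfirst := (pfirst xi).
Local Notation steps := (steps xi).
Local Notation pfree := (pfree xi).
Local Notation hup := (hup xi).
Local Open Scope ereal_scope.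

(** The leading 1 in [hup] is the term n = 0, where both conditions hold trivially. *)
Lemma hup_series x : hup x = \sum_(n <oo) pfree n x.
Proof.
pose A n := [set w | ladder_free n (steps w) /\ below (gaps x) n (steps w)].
have mA n : measurable (A n).
  exact: measurableI (measurable_Om_ladder_free _ n) (measurable_Om_below _ _ n).
rewrite [RHS](nneseries_recl (P := xpredT))//.
rewrite pfree0; congr (1 + _).
transitivity (\int[P]_w \sum_(n <oo) (\1_(A n.+1) w)%:E).
  apply: eq_integral => w _.
  rewrite -(@nneseries_addn _ (fun n => (\1_[set w' | _ /\ _] w)%:E) 1); last first.
    by move=> i; rewrite lee_fin.
  apply: eq_eseriesr => n _; rewrite addn1; congr (\1_ _ w)%:E.
  apply/seteqP; split=> w' /= -[h b]; split; try exact/lt_J1.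
    exact/(drawdown_below xi _ _ (ltn0Sn n)).
  exact/(drawdown_below xi _ _ (ltn0Sn n)).
rewrite integral_nneseries//; last by move=> n; apply/measurable_EFinP/measurable_indic.
rewrite -(@nneseries_addn _ (pfree ^~ x) 1); last by move=> i; exact: pfree_ge0.
apply: eq_eseriesr => n _; rewrite integral_indic// setIT addn1.
by congr (P _).
Qed.

Lemma hup_ge1 x : 1 <= hup x.
Proof.
rewrite leeDl// integral_ge0// => w _.
by apply: nneseries_ge0 => n _ _; rewrite lee_fin.
Qed.

Lemma hup_ge0 x : 0 <= hup x.
Proof. exact: le_trans (hup_ge1 x). Qed.

Lemma measurable_hup : measurable_fun setT hup.
Proof.
rewrite (_ : hup = fun x => \sum_(n <oo | n \in xpredT) pfree n x).
  apply: ge0_emeasurable_sum => [k x _ _|k _]; first exact: pfree_ge0.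
  exact: measurable_pfree.
by apply/funext => x; rewrite hup_series.
Qed.

Lemma measurable_hup_walk x k : measurable_fun setT (fun w => hup (walk xi x k w)).
Proof. exact: measurableT_comp measurable_hup (measurable_walk xi x k). Qed.

Section SpaceTimeEvents.
Variables (x : V) (E : nat -> set Om).
Hypothesis xW : weyl x.
Hypothesis pE : forall k, prefix xi k (E k).
Hypothesis Estay : forall k, E k `<=` [set w | stay x k (steps w)].

(* The sequences q and b, for E k = {L, T = k < tau}. *)
Definition stay_mass n :=
  \sum_(k < n.+1) \int[P]_(w in E k) pstay (n - k) (walk xi x k w).

Definition free_mass n :=
  \sum_(k < n.+1) \int[P]_(w in E k) pfree (n - k) (walk xi x k w).

Let mE k : measurable (E k).
Proof. exact: prefix_measurable (pE k). Qed.

Let mstay n k : measurable_fun (E k) (fun w => pstay n (walk xi x k w)).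
Proof.
apply: measurable_funTS.
exact: measurableT_comp (measurable_pstay xi n) (measurable_walk xi x k).
Qed.

Let mfree n k : measurable_fun (E k) (fun w => pfree n (walk xi x k w)).
Proof.
apply: measurable_funTS.
exact: measurableT_comp (measurable_pfree xi n) (measurable_walk xi x k).
Qed.

Lemma stay_mass_ge0 n : 0 <= stay_mass n.
Proof. by apply: sume_ge0 => k _; apply: integral_ge0. Qed.

Lemma free_mass_ge0 n : 0 <= free_mass n.
Proof. by apply: sume_ge0 => k _; apply: integral_ge0. Qed.

(** On [E k] the walk is in the chamber at time k, so the renewal equation for the start X_k and
    horizon n - k may be integrated over [E k]; summation over k then yields a convolution. *)
Lemma stay_mass_renewal n : stay_mass n = free_mass n + conv pfirst stay_mass n.
Proof.
pose g k j := (pfirst j)%:E * \int[P]_(w in E k) pstay (n - k - j) (walk xi x k w).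
have -> : conv pfirst stay_mass n = \sum_(k < n.+1) \sum_(j < (n - k).+1) g k j.
  rewrite sum_triangle_exchange; apply: eq_bigr => j _.
  rewrite ge0_sume_distrr; last by move=> k _; apply: integral_ge0.
  apply: eq_bigr => k _; rewrite /g; congr (_ * _).
  by apply: eq_integral => w _; rewrite subnAC.
rewrite -big_split /=; apply: eq_bigr => k _.
have W w : E k w -> forall i, (0 <= tnth (gaps (walk xi x k w)) i)%R.
  move=> /Estay /= xk i; apply/ltW; move: i; apply/weyl_gaps.
  (* At k = 0 [stay] says nothing, and [xW] supplies the membership. *)
  case: (posnP k) xk => [-> _|k0 xk]; last by apply: xk; rewrite k0 leqnn.
  apply/weyl_gaps => i; rewrite walk_steps gaps_path_walk /gap_sum big_ord0 addr0.
  by move: i; exact/weyl_gaps.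
transitivity (\int[P]_(w in E k) (pfree (n - k) (walk xi x k w) +
    conv pfirst (pstay ^~ (walk xi x k w)) (n - k))).
  by apply: eq_integral => w /set_mem Ew; rewrite -pstay_renewal//; exact: W.
have mterm (j : nat) : measurable_fun (E k)
    (fun w => (pfirst j)%:E * pstay (n - k - j) (walk xi x k w)).
  exact: measurable_funeM.
have term0 (j : nat) w : 0 <= (pfirst j)%:E * pstay (n - k - j) (walk xi x k w).
  by rewrite mule_ge0// lee_fin pfirst_ge0.
rewrite ge0_integralD//; last 2 first.
- by move=> w _; apply: sume_ge0.
- exact: emeasurable_sum.
congr (_ + _); rewrite ge0_integral_sum//.
by apply: eq_bigr => j _; rewrite ge0_integralZl//; rewrite lee_fin pfirst_ge0.
Qed.

Lemma sum_free_mass :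
  \sum_(n <oo) free_mass n = \sum_(k <oo) \int[P]_(w in E k) hup (walk xi x k w).
Proof.
rewrite (nneseries_antidiagonal
  (c := fun k m => \int[P]_(w in E k) pfree m (walk xi x k w))); last first.
  by move=> k m; apply: integral_ge0.
apply: eq_eseriesr => k _.
rewrite -integral_nneseries//.
by apply: eq_integral => w _; rewrite hup_series.
Qed.

Lemma stay_mass_measure n : trivIset setT E ->
  stay_mass n = P ((\bigcup_(k in [set k | (k <= n)%N]) E k) `&`
                   [set w | stay x n (steps w)]).
Proof.
move=> tE; rewrite setI_bigcupl.
rewrite (_ : [set k | (k <= n)%N] = [set k | (k < n.+1)%N])//.
rewrite bigcup_mkord
  (@measure_bigsetU _ _ _ P (fun k => E k `&` [set w | stay x n (steps w)]))//; last 2 first.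
- by move=> k; apply: measurableI => //; exact: measurable_Om_stay.
- by move=> i j _ _ [w [[Ei _] [Ej _]]]; apply: tE => //; exists w.
apply: eq_bigr => k _; have kn : (k <= n)%N by rewrite -ltnS.
by rewrite -prefix_stay_split// subnKC.
Qed.

End SpaceTimeEvents.

End RenewalFunction.

(** * Conditioning *)

Section RenewalEquation.
Context {R : realType}.
Variable f : nat -> R.
Hypothesis f0 : f 0 = 0.
Hypothesis f_ge0 : forall k, 0 <= f k.
Hypothesis f_le1 : (\sum_(k <oo) (f k)%:E <= 1)%E.
Local Open Scope ereal_scope.

(** As f 0 = 0, only powers s^k <= s occur. Hence 1 - F(s) > 0 for s < 1 even when f has total mass
    1. *)
Let fin_f_aux s : (0 <= s <= 1)%R -> genfun s (EFin \o f) <= s%:E.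
Proof.
move=> /andP[s0 s1]; apply: (@le_trans _ _ (s%:E * \sum_(k <oo) (f k)%:E)).
  rewrite -nneseriesZl; last by move=> k _; rewrite lee_fin.
  apply: lee_nneseries => [k _ _|k _].
    by rewrite -EFinM lee_fin mulr_ge0// exprn_ge0.
  rewrite -!EFinM lee_fin; case: k => [|k]; first by rewrite f0 !mulr0.
  by rewrite ler_wpM2r// exprS ler_piMr// exprn_ile1.
by rewrite -[leRHS]mule1 lee_wpmul2l// lee_fin.
Qed.

Lemma genfun_fin_f s : (0 <= s <= 1)%R -> genfun s (EFin \o f) \is a fin_num.
Proof.
move=> s01; have /andP[s0 _] := s01.
rewrite ge0_fin_numE; last by apply: genfun_ge0 => // k; rewrite lee_fin.
exact: le_lt_trans (fin_f_aux s01) (ltry _).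
Qed.

Lemma fine_genfun_lt1 s : (0 <= s < 1)%R -> (fine (genfun s (EFin \o f)) < 1)%R.
Proof.
move=> /andP[s0 s1]; have s01 : (0 <= s <= 1)%R by rewrite s0 ltW.
rewrite -lte_fin fineK ?genfun_fin_f//.
by apply: le_lt_trans (fin_f_aux s01) _; rewrite lte_fin.
Qed.

(** Boundedness of q makes Q(s) finite for s < 1, and b <= q does the same for B(s); only then can
    the equation be solved in the reals. *)
Lemma renewal_solution s (q b : nat -> \bar R) : (0 <= s < 1)%R ->
  (forall n, 0 <= q n <= 1) -> (forall n, 0 <= b n) ->
  (forall n, q n = b n + conv f q n) ->
  genfun s b \is a fin_num /\
  fine (genfun s b) =
    ((1 - fine (genfun s (EFin \o f))) * fine (genfun s q))%R.
Proof.
move=> s01 q01 b0 qE; have /andP[s0 s1] := s01.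
have q0 n : 0 <= q n by have /andP[] := q01 n.
have Qfin := genfun_fin_num s01 q01.
have Ffin : genfun s (EFin \o f) \is a fin_num.
  by apply: genfun_fin_f; rewrite s0 ltW.
have Bfin : genfun s b \is a fin_num.
  rewrite ge0_fin_numE ?genfun_ge0//.
  apply: (@le_lt_trans _ _ (genfun s q)); last by rewrite ltey_eq Qfin.
  by apply: le_genfun => // n; rewrite qE leeDl// conv_ge0.
split=> //.
have : genfun s q = genfun s b + genfun s (EFin \o f) * genfun s q.
  rewrite -genfun_conv// -genfunD//; last exact: conv_ge0.
  by apply: eq_eseriesr => n _; rewrite -qE.
move=> /(congr1 fine); rewrite fineD ?fin_numM// fineM//.
by rewrite mulrBl mul1r => {1}->; rewrite addrK.
Qed.

End RenewalEquation.

Section Conditioning.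
Context {R : realType} {dO : measure_display} {Om : measurableType dO}.
Variables (P : probability Om R) (d : nat) (xi : nat -> {RV P >-> d.-tuple R}).
Hypothesis xi_indep : mutually_independent xi.
Hypothesis xi_ident : identically_distributed xi.
Local Notation V := (d.-tuple R).
Local Notation pstay := (pstay xi).
Local Notation pfree := (pfree xi).
Local Notation steps := (steps xi).
Local Notation hup := (hup xi).
Local Open Scope ereal_scope.

Definition stopped_at x T (L : set Om) k :=
  L `&` [set w | T w = Some k] `&` [set w | stay x k (steps w)].

Lemma stopped_at_stay x T L k : stopped_at x T L k `<=` [set w | stay x k (steps w)].
Proof. by move=> w []. Qed.

Lemma stopped_at_trivIset x T L : trivIset setT (stopped_at x T L).
Proof. by move=> i j _ _ [w [[[_ /= Ti] _] [[_ /= ] +]]]; rewrite Ti => -[]. Qed.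

Lemma bigcup_stopped_at x T L :
  \bigcup_k stopped_at x T L k = L `&` [set w | etime (T w) < exit_time xi x w].
Proof.
apply/seteqP; split=> [w [k _ [[Lw /= Tk] xk]]|w [Lw /= Tx]].
  by split=> //=; rewrite Tk; exact/lt_exit_time.
by have [k Tk xk] := etime_lt_exit_time Tx; exists k.
Qed.

Lemma Pup_series x T L : (forall k, prefix xi k (stopped_at x T L k)) ->
  Pup xi x T L =
  ((fine (hup x))^-1)%:E * \sum_(n <oo) free_mass xi x (stopped_at x T L) n.
Proof.
move=> pE; have mE k := prefix_measurable (pE k).
have hE k w : w \in stopped_at x T L k ->
    hup (walk xi x k w) = hup (walk xi x (odflt 0%N (T w)) w).
  by rewrite inE => -[[_ /= ->]].
rewrite (sum_free_mass x pE) /Pup -bigcup_stopped_at.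
rewrite ge0_integral_bigcup; first last.
- exact: stopped_at_trivIset.
- by move=> w _; exact: hup_ge0.
- apply/measurable_fun_bigcup => // k; apply: (eq_measurable_fun _ (hE k)).
  exact/measurable_funTS/measurable_hup_walk.
- exact: mE.
apply: congr1; apply: eq_eseriesr => k _.
by apply: eq_integral => w wE; exact: esym (hE k w wE).
Qed.

Section FixedStart.
Variables (x : V) (E : nat -> set Om).
Hypothesis xW : weyl x.
Hypothesis pE : forall k, prefix xi k (E k).
Hypothesis Estay : forall k, E k `<=` [set w | stay x k (steps w)].
Hypothesis tE : trivIset setT E.
Local Notation q := (stay_mass xi x E).
Local Notation b := (free_mass xi x E).

Lemma stay_mass_le n : q n <= pstay n x.
Proof.
rewrite (stay_mass_measure xi_indep xi_ident pE Estay _ tE).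
apply: le_measure; rewrite ?inE; last exact: subIsetr.
- apply: measurableI; last exact: measurable_Om_stay.
  by apply: bigcup_measurable => k _; exact: prefix_measurable (pE k).
- exact: measurable_Om_stay.
Qed.

Lemma stay_mass01 n : 0 <= q n <= 1.
Proof.
rewrite stay_mass_ge0 (le_trans (stay_mass_le n))//.
by have /andP[] := pstay01 xi n x.
Qed.

Let gx k : (0 <= tnth (gaps x) k)%R.
Proof. by apply/ltW; move: k; exact/weyl_gaps. Qed.

Let solve_q s (s01 : (0 <= s < 1)%R) := renewal_solution (pfirst0 xi)
  (pfirst_ge0 xi) (sum_pfirst_le1 xi) s01 stay_mass01 (free_mass_ge0 xi x E)
  (stay_mass_renewal xi_indep xi_ident xW pE Estay).

Let solve_a s (s01 : (0 <= s < 1)%R) := renewal_solution (pfirst0 xi)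
  (pfirst_ge0 xi) (sum_pfirst_le1 xi) s01 (pstay01 xi ^~ x) (pfree_ge0 xi ^~ x)
  (fun n => pstay_renewal xi_indep xi_ident n gx).

Lemma genfun_ratio s : (0 <= s < 1)%R ->
  (fine (genfun s q) / fine (genfun s (pstay ^~ x)) =
   fine (genfun s b) / fine (genfun s (pfree ^~ x)))%R.
Proof.
move=> s01; have [_ ->] := solve_q s01; have [_ ->] := solve_a s01.
rewrite -mulf_div divff ?mul1r// gt_eqF// subr_gt0.
exact: (fine_genfun_lt1 (pfirst0 xi) (pfirst_ge0 xi) (sum_pfirst_le1 xi)).
Qed.

(** The sequence b need not lie below u term by term. The comparison holds for q <= a and is
    transferred by the common factor 1 - F(s). *)
Lemma le_genfun_free_mass s : (0 <= s < 1)%R ->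
  genfun s b <= genfun s (pfree ^~ x).
Proof.
move=> s01; have [Bfin BE] := solve_q s01; have [Ufin UE] := solve_a s01.
have /andP[s0 _] := s01.
rewrite -(fineK Bfin) -(fineK Ufin) lee_fin BE UE ler_wpM2l//.
  rewrite subr_ge0 ltW//.
  exact: (fine_genfun_lt1 (pfirst0 xi) (pfirst_ge0 xi) (sum_pfirst_le1 xi)).
rewrite fine_le//;
  last by apply: le_genfun => // n; [exact: stay_mass_ge0|exact: stay_mass_le].
  by apply: genfun_fin_num => // n; exact: stay_mass01.
by apply: genfun_fin_num => // n; exact: pstay01.
Qed.

(** For the events of a stopping time this is superharmonicity of h for the killed walk; it makes
    the limit in [genfun_ratio_cvg] finite. *)
Lemma sum_free_mass_le_hup : \sum_(n <oo) b n <= hup x.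
Proof.
have := genfun_cvg (free_mass_ge0 xi x E); apply: cvge_le; near=> c.
have c0 : (0 < c)%R by near: c; exact: nbhs_right_gt.
apply: (le_trans (le_genfun_free_mass (expRN_lt1 c0))).
rewrite (hup_series xi x) -genfun1; apply: le_genfun_l => [|k].
  by have /andP[-> /ltW] := expRN_lt1 c0.
exact: pfree_ge0.
Unshelve. all: by end_near. Qed.

Hypothesis hup_fin : hup x < +oo.

Lemma genfun_ratio_cvg :
  (fine (genfun (expR (- c)) q) /
   fine (genfun (expR (- c)) (pstay ^~ x)))%:E @[c --> (0%R : R)^'+] -->
  ((fine (hup x))^-1)%:E * \sum_(n <oo) b n.
Proof.
have hfin : hup x \is a fin_num by rewrite ge0_fin_numE// hup_ge0.
have bfin : \sum_(n <oo) b n \is a fin_num.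
  rewrite ge0_fin_numE; first exact: le_lt_trans sum_free_mass_le_hup _.
  by apply: nneseries_ge0 => n _ _; exact: free_mass_ge0.
rewrite -(fineK bfin) -EFinM mulrC; apply: cvg_EFin; first exact: nearW.
apply: (@cvg_trans _ ((fine (genfun (expR (- c)) b) /
    fine (genfun (expR (- c)) (pfree ^~ x)))%R @[c --> (0%R : R)^'+])).
  apply: near_eq_cvg; near=> c.
  by rewrite /= genfun_ratio// expRN_lt1//; near: c; exact: nbhs_right_gt.
apply: cvgM.
  by apply: fine_cvg; rewrite (fineK bfin); apply: genfun_cvg => n; exact: free_mass_ge0.
(* The denominator tends to h(x) >= 1, so the quotient is continuous there. *)
apply: cvgV.
  rewrite gt_eqF// -lte_fin fineK// (lt_le_trans _ (hup_ge1 xi x))//.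
apply: fine_cvg; rewrite (fineK hfin) hup_series.
by apply: genfun_cvg => n; exact: pfree_ge0.
Unshelve. all: by end_near. Qed.

End FixedStart.

(** Splitting by the value of N turns an event at the geometric time into a generating function at s
    = exp(-c). *)
Lemma geometric_mixture c (N : {RV P >-> nat}) (A : nat -> set Om) : (0 < c)%R ->
  geometric_time P c N -> independent_of P N (past_oo (walk xi (vzero d))) ->
  (forall n, measurable (A n)) ->
  (forall n, past_oo (walk xi (vzero d)) (A n)) ->
  P [set w | A (N w) w] =
  (1 - expR (- c))%:E * genfun (expR (- c)) (fun n => P (A n)).
Proof.
move=> c0 Ngeom Nind mA pA.
have mN n : measurable (N @^-1` [set n]).
  by rewrite -[X in measurable X]setTI; exact: measurable_funPT.
have -> : [set w | A (N w) w] = \bigcup_n (A n `&` N @^-1` [set n]).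
  by apply/seteqP; split=> [w Aw|w [n _ [Aw /= Nn]]]; [exists (N w) | rewrite /= Nn].
rewrite measure_semi_bigcup; last 3 first.
- by move=> n; exact: measurableI.
- by move=> i j _ _ [w [[_ /= <-] [_ /= <-]]].
- by apply: bigcup_measurable => n _; exact: measurableI.
rewrite -nneseriesZl; last first.
  by move=> n _; rewrite mule_ge0// lee_fin exprn_ge0// expR_ge0.
apply: eq_eseriesr => n _; rewrite [LHS](Nind _ _ (pA n)).
rewrite (_ : _ @^-1` _ = [set w | N w = n])//.
rewrite Ngeom// EFinM (_ : - (c * n%:R) = n%:R * - c)%R; last by ring.
by rewrite expRM_natl muleA muleC (muleC (P (A n))).
Qed.

End Conditioning.

(** * Densities *)

Section Density.
Context {R : realType} {dT : measure_display} {T : measurableType dT}.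
Variables (mu : {measure set T -> \bar R}) (f : T -> \bar R).
Local Open Scope ereal_scope.
Hypothesis mf : measurable_fun setT f.
Hypothesis f0 : forall t, 0 <= f t.
Import HBNNSimple.

Definition density (A : set T) : \bar R := \int[mu]_(t in A) f t.

Let density0 : density set0 = 0.
Proof. exact: integral_set0. Qed.

Let density_ge0 A : 0 <= density A.
Proof. by apply: integral_ge0. Qed.

Let density_sigma_additive : semi_sigma_additive density.
Proof.
move=> F mF tF mUF; rewrite /density ge0_integral_bigcup//; last first.
  exact: measurable_funTS.
by apply: is_cvg_nneseries => n _ _; apply: integral_ge0.
Qed.

Definition density_measure : {measure set T -> \bar R} :=
  HB.pack_for {measure set T -> \bar R} density
    (isMeasure.Build _ _ _ density density0 density_ge0 density_sigma_additive).

Lemma integral_density A (g : T -> \bar R) : measurable A ->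
  measurable_fun setT g -> (forall t, 0 <= g t) ->
  (forall t, f t \is a fin_num) ->
  \int[density_measure]_(t in A) g t = \int[mu]_(t in A) (f t * g t).
Proof.
move=> mA mg g0 ffin.
pose h := nnsfun_approx measurableT mg.
have hg t : (h n t)%:E @[n --> \oo] --> g t.
  by apply: cvg_nnsfun_approx => // *.
have ndh t m n : (m <= n)%N -> ((h m t)%:E <= (h n t)%:E).
  by move=> mn; rewrite lee_fin; exact/lefP/nd_nnsfun_approx.
have indicE n (r : R) : (0 <= r)%R ->
    \int[density_measure]_(t in A) (r%:E * (\1_(h n @^-1` [set r]) t)%:E) =
    \int[mu]_(t in A) (f t * (r%:E * (\1_(h n @^-1` [set r]) t)%:E)).
  move=> r0; rewrite ge0_integralZl//; last exact/measurable_EFinP/measurable_funTS.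
  rewrite integral_indic// -[X in _ * X]/(\int[mu]_(t in _) f t).
  rewrite setIC integral_mkcondr epatch_indic.
  rewrite -ge0_integralZl//; last 2 first.
  - apply: emeasurable_funM; first exact: measurable_funTS.
    exact/measurable_EFinP/measurable_funTS.
  - by move=> t _; rewrite mule_ge0// lee_fin.
  by apply: eq_integral => t _; rewrite /= muleCA.
transitivity (limn (fun n => \int[density_measure]_(t in A) (h n t)%:E)).
  rewrite -monotone_convergence//.
  - by apply: eq_integral => t _; apply/esym/cvg_lim.
  - by move=> n; apply/measurable_EFinP/measurable_funTS.
  - by move=> n t _; rewrite lee_fin.
  - by move=> t _ m n mn; exact: ndh.
rewrite [X in limn X](_ : _ = fun n => \int[mu]_(t in A) (f t * (h n t)%:E)).
  rewrite -monotone_convergence//.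
  - apply: eq_integral => t _; apply/cvg_lim => //.
    by apply: cvgeZl.
  - move=> n; apply: emeasurable_funM; first exact: measurable_funTS.
    exact/measurable_EFinP/measurable_funTS.
  - by move=> n t _; rewrite mule_ge0// lee_fin.
  - by move=> t _ m n mn; rewrite lee_wpmul2l// ndh.
apply/funext => n.
have hE t : (h n t)%:E =
    \sum_(r \in range (h n)) r%:E * (\1_(h n @^-1` [set r]) t)%:E.
  by rewrite fimfunE -fsumEFin//.
have mI r : measurable_fun A (fun t => r%:E * (\1_(h n @^-1` [set r]) t)%:E).
  by apply: measurable_funeM; exact/measurable_EFinP/measurable_funTS.
have I0 r t : 0 <= r%:E * (\1_(h n @^-1` [set r]) t)%:E.
  exact: nnfun_muleindic_ge0.
under eq_integral do rewrite hE.
rewrite ge0_integral_fsum//.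
transitivity (\sum_(r \in range (h n))
    \int[mu]_(t in A) (f t * (r%:E * (\1_(h n @^-1` [set r]) t)%:E))).
  apply: eq_fsbigr => r /set_mem [t _ <-].
  by apply: indicE; exact: fun_ge0.
rewrite -ge0_integral_fsum//.
- apply: eq_integral => t _; rewrite hE.
  by rewrite -ge0_mule_fsumr.
- move=> r; apply: emeasurable_funM => //; exact: measurable_funTS.
- by move=> r t _; rewrite mule_ge0.
Qed.

End Density.

(** * The conditional limit at a stopping time *)

Section Limit.
Context {R : realType} {dO : measure_display} {Om : measurableType dO}.
Variables (P : probability Om R) (d : nat) (xi : nat -> {RV P >-> d.-tuple R}).
Hypothesis xi_indep : mutually_independent xi.
Hypothesis xi_ident : identically_distributed xi.
Local Notation steps := (steps xi).
Local Notation pstay := (pstay xi).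
Local Notation hup := (hup xi).
Local Open Scope ereal_scope.

Lemma stopped_past_before x T L n : stopped_past (R := R) (walk xi x) T L ->
  prefix xi n (L `&` [set w | exists2 k, (k <= n)%N & T w = Some k]).
Proof.
move=> [_ /(_ n)/past_prefix]; congr (prefix xi n (L `&` _)).
apply/seteqP; split=> w /=.
  by case: (T w) => [k|//]; rewrite lee_fin ler_nat => kn; exists k.
by move=> [k kn ->]; rewrite lee_fin ler_nat.
Qed.

(** For positive k, the part of [L] on T = k is the difference of its parts on T <= k and on T <= k
    - 1, both known from membership in F_T. *)
Lemma stopped_at_prefix x T L k : stopped_past (R := R) (walk xi x) T L ->
  prefix xi k (stopped_at xi x T L k).
Proof.
move=> LT; apply: prefixI; last exact: prefix_stay.
have Lk := stopped_past_before k LT.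
case: k Lk => [|k] Lk.
  move: Lk; congr (prefix xi 0 (L `&` _)); apply/seteqP; split=> w /=.
    by move=> [k]; rewrite leqn0 => /eqP ->.
  by move=> Tw; exists 0%N.
have := prefixD Lk (prefixS (leqnSn k) (stopped_past_before k LT)).
congr (prefix xi k.+1 _); apply/seteqP.
split=> [w [[Lw [j jk Tj]] nLw]|w [Lw /= Tk]].
  split=> //=; rewrite Tj; congr Some; apply/eqP; rewrite eqn_leq jk/= ltnNge.
  by apply/negP => jk'; apply: nLw; split=> //; exists j.
split; first by split=> //; exists k.+1.
by move=> [_ [j jk]]; rewrite Tk => -[kj]; rewrite -kj ltnn in jk.
Qed.

Lemma stopped_before_stay x T L n :
  (\bigcup_(k in [set k | (k <= n)%N]) stopped_at xi x T L k) `&`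
    [set w | stay x n (steps w)] =
  L `&` [set w | etime (T w) <= (n%:R)%:E :> \bar R] `&` [set w | stay x n (steps w)].
Proof.
apply/seteqP; split=> [w [[k kn [[Lw /= Tk] _]] xn]|w [[Lw Tn] xn]].
  by do 2!split=> //=; rewrite Tk lee_fin ler_nat.
split=> //; move: Tn => /=; case Tk : (T w) => [k|//].
rewrite lee_fin ler_nat => kn; exists k => //; split=> //.
by move=> i /andP[i0 ik]; apply: xn; rewrite i0 (leq_trans ik).
Qed.

Lemma cond_prob_cvg x T L (N : R -> {RV P >-> nat}) : weyl x -> hup x < +oo ->
  (forall c : R, (0 < c)%R -> geometric_time P c (N c)) ->
  (forall c : R, (0 < c)%R ->
    independent_of P (N c) (past_oo (walk xi (vzero d)))) ->
  stopped_past (R := R) (walk xi x) T L ->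
  ((cond_prob P (L `&` [set w | (etime (T w) <= ((N c w)%:R)%:E :> \bar R)%E])
     (stays xi x (N c)))%:E @[c --> (0 : R)^'+] --> Pup xi x T L)%R.
Proof.
move=> xW hfin Ngeom Nind LT.
have pE k := stopped_at_prefix k LT.
have Estay := @stopped_at_stay _ _ _ P d xi x T L.
have tE := @stopped_at_trivIset _ _ _ P d xi x T L.
rewrite (Pup_series pE).
apply: cvg_trans (genfun_ratio_cvg xi_indep xi_ident xW pE Estay tE hfin).
apply: near_eq_cvg; near=> c.
(* Below, [A n] is the event L, T <= n < tau. It belongs to the past at time n, so it is independent
   of N and the mixture formula applies. *)
have c0 : (0 < c)%R by near: c; exact: nbhs_right_gt.
pose A n := L `&` [set w | etime (T w) <= (n%:R)%:E :> \bar R] `&`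
  [set w | stay x n (steps w)].
have pA n : past (walk xi x) n (A n).
  by apply: pastI; [exact: LT.2 | exact: past_stay].
have mA n : measurable (A n) by exact: past_measurable (pA n).
have EN : P (stays xi x (N c)) =
    (1 - expR (- c))%:E * genfun (expR (- c)) (pstay ^~ x).
  apply: (geometric_mixture c0 (Ngeom c c0) (Nind c c0)
    (A := fun n => [set w | stay x n (steps w)])).
    by move=> n; exact: measurable_Om_stay.
  by move=> n; apply: (@past_past_oo _ _ _ P d xi x _ n); exact: past_stay.
have EA : P ((L `&` [set w | (etime (T w) <= ((N c w)%:R)%:E :> \bar R)]) `&`
      stays xi x (N c)) =
    (1 - expR (- c))%:E * genfun (expR (- c)) (stay_mass xi x (stopped_at xi x T L)).
  rewrite [LHS](geometric_mixture c0 (Ngeom c c0) (Nind c c0) mA); last first.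
    by move=> n; apply: (@past_past_oo _ _ _ P d xi x _ n); exact: pA.
  congr (_ * genfun _ _); apply/funext => n.
  rewrite (stay_mass_measure xi_indep xi_ident pE Estay n tE).
  by rewrite stopped_before_stay.
rewrite /cond_prob EN EA.
have s01 := expRN_lt1 c0.
rewrite !fineM//; last 2 first.
- by apply: genfun_fin_num => // n; exact: pstay01.
- apply: genfun_fin_num => // n.
  exact: (stay_mass01 xi_indep xi_ident pE Estay tE).
(* The normalisation 1 - exp(-c) of the geometric law cancels. *)
rewrite /= -mulf_div divff ?mul1r// gt_eqF// subr_gt0.
by have /andP[] := s01.
Unshelve. all: by end_near. Qed.

End Limit.

(** * Total mass *)

Section TotalMass.
Context {R : realType} {dO : measure_display} {Om : measurableType dO}.
Variables (P : probability Om R) (d : nat) (xi : nat -> {RV P >-> d.-tuple R}).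
Hypothesis xi_indep : mutually_independent xi.
Hypothesis xi_ident : identically_distributed xi.
Local Notation V := (d.-tuple R).
Local Notation pstay := (pstay xi).
Local Notation pfree := (pfree xi).
Local Notation hup := (hup xi).
Local Notation steps := (steps xi).
Local Notation pfirst := (pfirst xi).
Local Open Scope ereal_scope.

(* The probability of {J_1 < oo}. *)
Definition pladder := \sum_(k <oo) (pfirst k)%:E.

Lemma pladder_fin_num : pladder \is a fin_num.
Proof.
rewrite ge0_fin_numE; first exact: le_lt_trans (sum_pfirst_le1 xi) (ltry _).
by apply: nneseries_ge0 => k _ _; rewrite lee_fin pfirst_ge0.
Qed.

Lemma prefix_set0 n : prefix xi n set0.
Proof. by have [] := sigma_algebra_prefix xi n. Qed.

Lemma stopped_at_fixed x n L k : stopped_at xi x (fun=> Some n) L k =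
  if k == n then L `&` [set w | stay x n (steps w)] else set0.
Proof.
rewrite /stopped_at; case: eqP => [->|kn].
  by rewrite (_ : [set w | Some n = Some n] = setT) ?setIT//; apply/seteqP; split.
by apply/seteqP; split=> // w [[_ /= [nk]]]; rewrite nk in kn.
Qed.

Lemma stopped_at_fixed_prefix x n L k : prefix xi n L ->
  prefix xi k (stopped_at xi x (fun=> Some n) L k).
Proof.
move=> pL; rewrite stopped_at_fixed; case: eqP => [->|_]; last exact: prefix_set0.
by apply: prefixI => //; exact: prefix_stay.
Qed.

Lemma prefix_setT n : prefix xi n setT.
Proof. by exists setT => //; rewrite preimage_setT setTI. Qed.

Section FixedTime.
Variables (x : V) (n : nat).
Hypothesis xW : weyl x.
Local Notation E := (stopped_at xi x (fun=> Some n) setT).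
Local Notation q := (stay_mass xi x E).
Local Notation b := (free_mass xi x E).

Let pE k : prefix xi k (E k).
Proof. exact/stopped_at_fixed_prefix/prefix_setT. Qed.

Let Estay := @stopped_at_stay _ _ _ P d xi x (fun=> Some n) setT.

Let tE := @stopped_at_trivIset _ _ _ P d xi x (fun=> Some n) setT.

(** The part of a that q misses when T = n: survival at times before n. *)
Let early m := if (m < n)%N then pstay m x else 0.

Let early_ge0 m : 0 <= early m.
Proof. by rewrite /early; case: ifP. Qed.

Let pstay_split m : pstay m x = q m + early m.
Proof.
rewrite (stay_mass_measure xi_indep xi_ident pE Estay m tE) /early.
have [mn|nm] := ltnP m n.
  rewrite bigcup0 ?set0I ?measure0 ?add0e// => k /= km.
  by rewrite stopped_at_fixed ifF//; apply/eqP => kn; lia.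
rewrite adde0; congr (P _); apply/seteqP; split=> [w xm|w []//].
split=> //; exists n => //; rewrite stopped_at_fixed eqxx; split=> //.
by move=> i /andP[i0 ik]; apply: xm; rewrite i0 (leq_trans ik).
Qed.

(** Subtracting the renewal equation of q from that of a leaves u + f * early = b + early, which is
    summed over all times. The form is additive because finiteness of [hup x] is not assumed at this
    stage. *)
Lemma sum_free_mass_fixed :
  hup x + pladder * \sum_(m < n) pstay m x =
  \sum_(m <oo) b m + \sum_(m < n) pstay m x.
Proof.
have q01 m := stay_mass01 xi_indep xi_ident pE Estay tE m.
have q0 m : 0 <= q m by exact: stay_mass_ge0.
have b0 m : 0 <= b m by exact: free_mass_ge0.
have f0 k := pfirst_ge0 xi k.
have gx k : (0 <= tnth (gaps x) k)%R by apply/ltW; move: k; exact/weyl_gaps.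
have convD m : conv pfirst (pstay ^~ x) m = conv pfirst q m + conv pfirst early m.
  rewrite -big_split; apply: eq_bigr => k _ /=.
  by rewrite pstay_split ge0_muleDr.
have convq_fin m : conv pfirst q m \is a fin_num.
  apply/sum_fin_numP => k _ _; rewrite fin_numM//.
  rewrite ge0_fin_numE//; apply: le_lt_trans (ltry 1).
  by have /andP[] := q01 (m - k)%N.
(* The convolution of f with q is common to both equations and finite, so it cancels. *)
have term m : pfree m x + conv pfirst early m = b m + early m.
  have := pstay_renewal xi_indep xi_ident m gx.
  rewrite pstay_split convD [in LHS](stay_mass_renewal xi_indep xi_ident xW pE Estay).
  rewrite addeAC [RHS]addeCA [RHS]addeC.
  by move=> /(congr1 (fun z => z - conv pfirst q m)); rewrite !addeK.
have sum_early : \sum_(m <oo) early m = \sum_(m < n) pstay m x.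
  by rewrite (nneseries_mkord (q := pstay ^~ x)).
have early_fin : \sum_(m <oo) early m \is a fin_num.
  rewrite sum_early; apply/sum_fin_numP => m _ _.
  rewrite ge0_fin_numE//; apply: le_lt_trans (ltry 1).
  by have /andP[] := pstay01 xi m x.
have c0 := conv_ge0 f0 early_ge0.
have := genfunD ler01 (pfree_ge0 xi ^~ x) c0.
rewrite genfun_conv//; last by rewrite genfun1.
rewrite !genfun1 sum_early -hup_series -/pladder => <-.
rewrite -sum_early -nneseriesD//.
by apply: eq_eseriesr => m _; rewrite term.
Qed.

End FixedTime.

Hypothesis hup_fin : forall x, weyl x -> hup x < +oo.

Lemma hup_fin_num x : weyl x -> hup x \is a fin_num.
Proof. by move=> xW; rewrite ge0_fin_numE ?hup_fin// hup_ge0. Qed.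

Lemma fine_hup_gt0 x : weyl x -> (0 < fine (hup x))%R.
Proof.
move=> xW; rewrite -lte_fin (fineK (hup_fin_num xW)).
by apply: lt_le_trans (hup_ge1 xi x); rewrite lte01.
Qed.

(** The second summand is the mass lost by time n; both mass statements are read off its sign. *)
Lemma Pup_fixed x n : weyl x ->
  (Pup xi x (fun=> Some n) setT +
   ((fine (hup x))^-1 * ((1 - fine pladder) * \sum_(m < n) fine (pstay m x)))%:E = 1).
Proof.
move=> xW; rewrite Pup_series; last first.
  by move=> k; exact/stopped_at_fixed_prefix/prefix_setT.
have bfin : \sum_(m <oo) free_mass xi x (stopped_at xi x (fun=> Some n) setT) m
    \is a fin_num.
  rewrite ge0_fin_numE; last by apply: nneseries_ge0 => m _ _; exact: free_mass_ge0.
  apply: le_lt_trans (hup_fin xW).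
  apply: sum_free_mass_le_hup => //; last exact: stopped_at_trivIset.
  - by move=> k; exact/stopped_at_fixed_prefix/prefix_setT.
  - exact: stopped_at_stay.
have := sum_free_mass_fixed n xW.
have -> : \sum_(m < n) pstay m x = (\sum_(m < n) fine (pstay m x))%:E.
  rewrite -sumEFin; apply: eq_bigr => m _; rewrite fineK//.
  by rewrite fin_num_measure//; exact: measurable_Om_stay.
rewrite -(fineK (hup_fin_num xW)) -(fineK pladder_fin_num) -(fineK bfin).
rewrite -!EFinM -!EFinD => -[hE]; congr EFin.
rewrite -mulrDr mulrBl mul1r addrA -hE addrK mulVf//.
by rewrite gt_eqF// fine_hup_gt0.
Qed.

Lemma Pup_fixed_le1 x n : weyl x -> Pup xi x (fun=> Some n) setT <= 1.
Proof.
move=> xW; rewrite -(Pup_fixed n xW) leeDl// lee_fin.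
rewrite mulr_ge0// ?invr_ge0 ?(ltW (fine_hup_gt0 xW))// mulr_ge0//.
  rewrite subr_ge0 -lee_fin (fineK pladder_fin_num).
  exact: sum_pfirst_le1.
by apply: sumr_ge0 => m _; apply: fine_ge0.
Qed.

Lemma Pup_fixed_lt1 x n : weyl x -> (0 < n)%N -> pladder < 1 ->
  Pup xi x (fun=> Some n) setT < 1.
Proof.
move=> xW n0 lad; rewrite -(Pup_fixed n xW) lteDl ?lte_fin; last first.
  have := Pup_fixed_le1 n xW.
  rewrite fin_numE -ltey => /le_lt_trans -> //; last exact: ltry.
  rewrite andbT -ltNye; apply: (@lt_le_trans _ _ 0) => //.
  rewrite mule_ge0 ?lee_fin ?invr_ge0 ?(ltW (fine_hup_gt0 xW))//.
  by apply: integral_ge0 => w _; exact: hup_ge0.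
rewrite mulr_gt0 ?invr_gt0 ?fine_hup_gt0// mulr_gt0//.
  by rewrite subr_gt0 -lte_fin (fineK pladder_fin_num).
(* The term m = 0 equals 1, so mass is already lost at the first step. *)
case: n n0 => // n _; rewrite big_ord_recl pstay0 /= ltr_pwDl//.
by apply: sumr_ge0 => m _; apply: fine_ge0.
Qed.

Lemma Pup_fixed_eq1 x n : weyl x -> pladder = 1 -> Pup xi x (fun=> Some n) setT = 1.
Proof.
move=> xW lad; rewrite -[RHS](Pup_fixed n xW) lad /= subrr mul0r mulr0.
by rewrite adde0.
Qed.

Lemma exit_time_mean x :
  \int[P]_w exit_time xi x w = \sum_(n <oo) pstay n x.
Proof.
transitivity (\int[P]_w \sum_(n <oo) (\1_[set w | stay x n (steps w)] w)%:E).
  apply: eq_integral => w _; rewrite /exit_time first_time_series.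
  apply: eq_eseriesr => n _; rewrite indicE.
  rewrite (_ : (w \in _) = `[< stay x n (steps w) >]); last first.
    by apply/idP/asboolP; rewrite inE.
  rewrite (asbool_equiv_eq (Q := stay x n (steps w))); first by case: ifP.
  rewrite -(@lt_exit_time _ _ _ P d xi x n w) /=.
  by rewrite /exit_time lt_first_time.
rewrite integral_nneseries//; last first.
  by move=> n; apply/measurable_EFinP/measurable_indic/measurable_Om_stay.
apply: eq_eseriesr => n _; rewrite integral_indic ?setIT//.
exact: measurable_Om_stay.
Qed.

Let gaps0 : gaps (vzero d) = vzero d.-1 :> d.-1.-tuple R.
Proof.
by apply: eq_from_tnth => k; rewrite !tnth_mktuple tnth_nseq !nth_nseq !if_same subrr.
Qed.

(** At vanishing gaps and positive n, [below] is the event of a ladder time at n, which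
    [ladder_free] excludes. *)
Lemma pfree_vzero n : pfree n (vzero d) = (n == 0%N)%:R%:E.
Proof.
case: n => [|n]; first by rewrite pfree0.
rewrite /pfree gaps0 (_ : [set w | _] = set0) ?measure0//.
apply/seteqP; split=> // w [lf lad].
by apply: (lf n.+1).
Qed.

Let gaps0_ge0 k : (0 <= tnth (gaps (vzero d : V)) k)%R.
Proof. by rewrite gaps0 tnth_nseq. Qed.

Lemma sum_pfree_vzero s : genfun s (pfree ^~ (vzero d)) = 1.
Proof.
rewrite /genfun (eq_eseriesr (g := fun n => if (n < 1)%N then 1 else 0)); last first.
  by move=> [|n] _; rewrite pfree_vzero ?mule1 ?expr0 // mule0.
by rewrite -(nneseries_mkord (q := fun=> 1))// big_ord1.
Qed.

(** At s = 1 the equation at the origin reads A = 1 + p A with A = E(tau) finite and p = [pladder];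
    this excludes p = 1. *)
Lemma pladder_lt1 : \int[P]_w exit_time xi (vzero d) w < +oo -> pladder < 1.
Proof.
rewrite exit_time_mean => tfin.
have Afin : \sum_(n <oo) pstay n (vzero d) \is a fin_num.
  by rewrite ge0_fin_numE//; apply: nneseries_ge0.
rewrite lt_neqAle sum_pfirst_le1 andbT; apply/eqP => lad.
have : genfun 1 (pstay ^~ (vzero d)) =
    genfun 1 (pfree ^~ (vzero d)) + pladder * genfun 1 (pstay ^~ (vzero d)).
  have p0 n : 0 <= pstay n (vzero d) by have /andP[] := pstay01 xi n (vzero d).
  have c0 := conv_ge0 (pfirst_ge0 xi) p0.
  rewrite [pladder](_ : _ = genfun 1 (EFin \o pfirst)); last by rewrite genfun1.
  rewrite -genfun_conv//; [|exact: pfirst_ge0|by rewrite genfun1].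
  rewrite -genfunD//.
  by apply: eq_eseriesr => n _; rewrite -pstay_renewal.
rewrite lad mul1e sum_pfree_vzero.
rewrite genfun1 -(fineK Afin) -EFinD => -[h].
have := oner_neq0 R.
by rewrite -[1%R](addrK (fine (\sum_(n <oo) pstay n (vzero d)))) -h subrr eqxx.
Qed.

(** If p = [pladder] were below 1, then A(s) = 1 / (1 - F(s)) <= 1 / (1 - p) for all s < 1, and this
    bound would pass to E(tau). *)
Lemma pladder_eq1 : \int[P]_w exit_time xi (vzero d) w = +oo -> pladder = 1.
Proof.
rewrite exit_time_mean => tinf; apply/eqP; rewrite eq_le sum_pfirst_le1/= leNgt.
apply/negP => lad.
have p0 n : 0 <= pstay n (vzero d) by have /andP[] := pstay01 xi n (vzero d).
have lad1 : (0 < 1 - fine pladder)%R.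
  by rewrite subr_gt0 -lte_fin (fineK pladder_fin_num).
suff : +oo <= ((1 - fine pladder)^-1)%:E by rewrite leNgt ltry.
rewrite -tinf; have := genfun_cvg p0; apply: cvge_le; near=> c.
have c0 : (0 < c)%R by near: c; exact: nbhs_right_gt.
have s01 := expRN_lt1 c0; have /andP[s0 s1] := s01.
have [_] := renewal_solution (pfirst0 xi) (pfirst_ge0 xi) (sum_pfirst_le1 xi) s01
  (pstay01 xi ^~ (vzero d)) (pfree_ge0 xi ^~ (vzero d))
  (fun n => pstay_renewal xi_indep xi_ident n gaps0_ge0).
rewrite sum_pfree_vzero /= => one.
have Gfin := genfun_fin_num s01 (pstay01 xi ^~ (vzero d)).
have Ffin : genfun (expR (- c)) (EFin \o pfirst) \is a fin_num.
  apply: (genfun_fin_f (pfirst0 xi) (pfirst_ge0 xi) (sum_pfirst_le1 xi)).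
  by rewrite s0 ltW.
rewrite -(fineK Gfin) lee_fin -div1r ler_pdivlMr// [leRHS]one mulrC.
rewrite ler_wpM2r ?fine_ge0 ?genfun_ge0// lerB//.
rewrite -lee_fin (fineK Ffin) (fineK pladder_fin_num).
rewrite /pladder -genfun1; apply: le_genfun_l => [|k]; first by rewrite s0 ltW.
by rewrite lee_fin pfirst_ge0.
Unshelve. all: by end_near. Qed.

End TotalMass.

(** * The transition kernel *)

Section DoobTransform.
Context {R : realType} {dO : measure_display} {Om : measurableType dO}.
Variables (P : probability Om R) (d : nat) (xi : nat -> {RV P >-> d.-tuple R}).
Hypothesis xi_indep : mutually_independent xi.
Hypothesis xi_ident : identically_distributed xi.
Local Notation V := (d.-tuple R).
Local Notation steps := (steps xi).
Local Notation hup := (hup xi).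
Local Notation W := (@weyl R d).
Local Open Scope ereal_scope.
Hypothesis hup_fin : forall x, W x -> hup x < +oo.

Lemma measurable_weyl_set : measurable W.
Proof. exact: (@measurable_weyl _ _ _ _ id). Qed.

Definition hup_on (B : set V) (u : V) : \bar R := (\1_(B `&` W) u)%:E * hup u.

Lemma hup_on_ge0 B u : 0 <= hup_on B u.
Proof. by rewrite mule_ge0// ?lee_fin// hup_ge0. Qed.

Lemma measurable_hup_on B : measurable B -> measurable_fun setT (hup_on B).
Proof.
move=> mB; apply: emeasurable_funM; last exact: measurable_hup.
apply/measurable_EFinP/measurable_indic/measurableI => //.
exact: measurable_weyl_set.
Qed.

Lemma integral_hup_on (f : Om -> V) (B : set V) (D : set Om) :
  (forall w, D w <-> B (f w) /\ W (f w)) ->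
  \int[P]_w hup_on B (f w) = \int[P]_(w in D) hup (f w).
Proof.
move=> DE; rewrite [RHS]integral_mkcond; apply: eq_integral => w _.
rewrite patchE /hup_on indicE.
rewrite (_ : (f w \in B `&` W) = (w \in D)).
  by case: ifP => _; rewrite ?mul1e ?mul0e.
by apply/idP/idP; rewrite !inE => /DE.
Qed.

(** The indicator makes the kernel vanish off the chamber, so that the bound by 1 holds at every
    point. *)
Let up_weight (z : V) : R := (\1_W z * (fine (hup z))^-1)%R.

Let up_weight_ge0 z : (0 <= up_weight z)%R.
Proof. by rewrite mulr_ge0// invr_ge0 fine_ge0// hup_ge0. Qed.

Let mjump z B : measurable B -> measurable_fun setT (fun w => hup_on B (walk xi z 1 w)).
Proof.
by move=> mB; exact: measurableT_comp (measurable_hup_on mB) (measurable_walk xi z 1).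
Qed.

(** The Doob transform is assembled from operations on measures: P with density h on the chamber
    after one step, pushed forward by that step, then scaled. *)
Definition up_kernel (z : V) : {measure set V -> \bar R} :=
  mscale (NngNum (up_weight_ge0 z))
    (image_measure (density_measure P (mjump z measurableT)
                      (fun w => hup_on_ge0 setT (walk xi z 1 w)))
       (measurable_walk xi z 1)).

Lemma up_kernelE z B :
  up_kernel z B = (up_weight z)%:E * \int[P]_w hup_on B (walk xi z 1 w).
Proof.
rewrite -[LHS]/((up_weight z)%:E *
  \int[P]_(w in walk xi z 1 @^-1` B) hup_on setT (walk xi z 1 w)).
congr (_ * _); rewrite integral_mkcond; apply: eq_integral => w _.
rewrite patchE /hup_on !indicE setTI in_setI.
rewrite (_ : (w \in _) = (walk xi z 1 w \in B)); last by apply/idP/idP; rewrite !inE.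
by case: ifP => //= _; rewrite mul0e.
Qed.

Let measurable_up_kernel U : measurable U -> measurable_fun setT (up_kernel ^~ U).
Proof.
move=> mU; apply: (eq_measurable_fun (fun z =>
    (up_weight z)%:E * \int[P]_w hup_on U (walk xi z 1 w))).
  by move=> z _; rewrite up_kernelE.
apply: emeasurable_funM.
  apply/measurable_EFinP/measurable_funM.
    by apply: measurable_indic; exact: measurable_weyl_set.
  (* The reciprocal is written as a power, a measurable function that agrees with it on nonnegative
     arguments. *)
  apply: (eq_measurable_fun (fun z => fine (hup z) `^ (- 1))%R).
    by move=> z _; rewrite powR_inv1// fine_ge0// hup_ge0.
  apply: measurableT_comp (measurable_powR _) _.
  by apply: measurableT_comp => //; exact: measurable_hup.
apply: (@measurable_fun_fubini_tonelli_F _ _ _ _ _ P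
  (fun zw : V * Om => hup_on U (walk xi zw.1 1 zw.2))).
  apply: measurableT_comp (measurable_hup_on mU) _.
  apply: (measurable_path_walk (X := fst) (e := fun zw => steps zw.2)) => // i.
  exact: measurableT_comp (measurable_steps xi i) measurable_snd.
by move=> zw; exact: hup_on_ge0.
Qed.

Let up_kernel_le1 z : up_kernel z setT <= 1.
Proof.
rewrite up_kernelE /up_weight indicE; case: (boolP (z \in W)) => [|_]; last first.
  by rewrite mul0r mul0e.
(* The mass of the kernel at z is the probability under P^up_z of surviving one step. *)
rewrite inE mul1r => zW; apply: le_trans (Pup_fixed_le1 xi_indep xi_ident hup_fin 1 zW).
rewrite /Pup setTI (@integral_hup_on _ _
  [set w | etime (Some 1%N) < exit_time xi z w])// => w /=.
rewrite lt_exit_time; split=> [h|[_ h] i].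
  by split=> //; exact: h.
by case: i => [|[|i]].
Qed.

HB.instance Definition _ := isKernel.Build _ _ _ _ _ up_kernel measurable_up_kernel.

HB.instance Definition _ := Kernel_isSubProbability.Build _ _ _ _ _ up_kernel
  ((sprob_kernelP (fun z B => up_kernel z B)).2 up_kernel_le1).

Lemma up_kernel_trans z B : W z -> measurable B -> up_kernel z B = trans_up xi z B.
Proof.
move=> zW mB; have mBW : measurable (B `&` W) := measurableI _ _ mB measurable_weyl_set.
rewrite up_kernelE /up_weight indicE mem_set// mul1r /trans_up.
rewrite ge0_integral_pushforward//; last 3 first.
- exact: measurable_walk.
- apply: measurable_funTS; apply: emeasurable_funM => //.
  exact: measurable_hup.
- by move=> u _; rewrite mule_ge0 ?hup_ge0// lee_fin invr_ge0 fine_ge0// hup_ge0.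
rewrite (@integral_hup_on (walk xi z 1) B (walk xi z 1 @^-1` (B `&` W)))//.
rewrite -ge0_integralZl//.
- by apply: eq_integral => w _ /=; rewrite muleC.
- by rewrite -[X in measurable X]setTI; exact: measurable_walk.
- exact/measurable_funTS/measurable_hup_walk.
- by move=> w _; exact: hup_ge0.
- by rewrite lee_fin invr_ge0 fine_ge0// hup_ge0.
Qed.

Section Chain.
Variable x : V.
Hypothesis xW : W x.

Let S n := [set w | stay x n (steps w)].

Let mS n : measurable (S n).
Proof. exact: measurable_Om_stay. Qed.

Let weight n (w : Om) : \bar R := (\1_(S n) w)%:E * hup (walk xi x n w).

Let mweight n : measurable_fun setT (weight n).
Proof.
apply: emeasurable_funM; last exact: measurable_hup_walk.
exact/measurable_EFinP/measurable_indic.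
Qed.

Let weight_ge0 n w : 0 <= weight n w.
Proof. by rewrite mule_ge0// ?lee_fin// hup_ge0. Qed.

Let walk_weyl n w : S n w -> W (walk xi x n w).
Proof.
case: n => [_|n Sw]; last by apply: Sw; rewrite leqnn.
apply/weyl_gaps => k; rewrite walk_steps gaps_path_walk /gap_sum big_ord0 addr0.
by move: k; exact/weyl_gaps.
Qed.

(** Required by [integral_density]: survival puts X_n in the chamber, where h is finite, and
    elsewhere the indicator gives 0. *)
Let weight_fin n w : weight n w \is a fin_num.
Proof.
rewrite /weight indicE; case: (boolP (_ \in _)) => [|_]; last by rewrite mul0e.
by rewrite inE => /walk_weyl Ww; rewrite mul1e (hup_fin_num hup_fin).
Qed.

Let c_ge0 : (0 <= (fine (hup x))^-1)%R.
Proof. by rewrite invr_ge0 fine_ge0// hup_ge0. Qed.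

Let mu n : {measure set Om -> \bar R} :=
  mscale (NngNum c_ge0) (density_measure P (mweight n) (weight_ge0 n)).

Let integral_weight n L :
  \int[P]_(w in L) weight n w = \int[P]_(w in L `&` S n) hup (walk xi x n w).
Proof.
rewrite integral_mkcondr; apply: eq_integral => w _.
by rewrite /weight patchE indicE; case: ifP => _; rewrite ?mul1e ?mul0e.
Qed.

Lemma Pup_fixedE n L : Pup xi x (fun=> Some n) L =
  ((fine (hup x))^-1)%:E * \int[P]_(w in L `&` S n) hup (walk xi x n w).
Proof.
rewrite /Pup (_ : [set w | _] = S n)//.
by apply/seteqP; split=> w /lt_exit_time.
Qed.

Let muE n L : mu n L = Pup xi x (fun=> Some n) L.
Proof.
rewrite Pup_fixedE -integral_weight.
exact: erefl.
Qed.

Let initial B : measurable B -> mu 0%N (walk xi x 0 @^-1` B) = \d_x B.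
Proof.
move=> mB; have x0 w : walk xi x 0 w = x.
  by apply: eq_from_tnth => k; rewrite tnth_mktuple big_ord0 addr0.
have S0 : S 0%N = setT.
  by apply/seteqP; split=> // w _ i; case: i.
rewrite muE Pup_fixedE S0 setIT.
have -> : \int[P]_(w in walk xi x 0 @^-1` B) hup (walk xi x 0 w) =
    \int[P]_(w in walk xi x 0 @^-1` B) cst (hup x) w.
  by apply: eq_integral => w _; rewrite x0.
rewrite (_ : walk xi x 0 @^-1` B = if x \in B then setT else set0); last first.
  apply/seteqP; split=> w /=; rewrite x0.
    by move=> Bx; rewrite mem_set.
  by case: ifPn => // /set_mem.
rewrite diracE; case: (x \in B); last by rewrite integral_set0 mule0.
rewrite integral_cst//.
rewrite [X in _ * (_ * X)](_ : _ = 1) ?mule1; last exact: probability_setT.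
rewrite -{2}(fineK (hup_fin_num hup_fin xW)) -EFinM mulVf//.
by rewrite gt_eqF// (fine_hup_gt0 hup_fin).
Qed.

(** The density h(X_n) of [mu n] cancels the factor 1 / h(X_n) of the kernel; what remains is the
    Markov property at time n for one further increment. *)
Let transition n L B : past (walk xi x) n L -> measurable B ->
  mu n.+1 (L `&` walk xi x n.+1 @^-1` B) =
  \int[mu n]_(w in L) up_kernel (walk xi x n w) B.
Proof.
move=> pL mB; have mL := past_measurable pL.
have mK : measurable_fun setT (fun w => up_kernel (walk xi x n w) B).
  exact: measurableT_comp (measurable_up_kernel mB) (measurable_walk xi x n).
have mE : measurable (L `&` S n) by exact: measurableI.
rewrite ge0_integral_mscale//; last exact: measurable_funTS.
rewrite (integral_density P (mweight n) (weight_ge0 n) mL mK _ (weight_fin n))//.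
rewrite muE Pup_fixedE; congr (_ * _).
pose F (z : V * 1.-tuple V) := hup_on B (path_walk z.1 (tuple_path z.2) 1).
have mF : measurable_fun setT F.
  apply: measurableT_comp (measurable_hup_on mB) _.
  apply: (measurable_path_walk (X := fst)) => // i.
  exact: measurableT_comp (measurable_tuple_path i) measurable_snd.
have FE a w w' : F (walk xi x n w, block xi a 1 w') =
    hup_on B (path_walk (walk xi x n w) (shift a (steps w')) 1).
  rewrite /F /=; congr (hup_on B _).
  by apply: (@eq_path_walk _ _ _ _ _ 1) => // j j1; rewrite tuple_path_block.
have stayS w : S n.+1 w <-> S n w /\ W (walk xi x n.+1 w).
  rewrite /S /=; split=> [h|[h1 h2] i /andP[i0]].
    split; last by apply: h; rewrite leqnn.
    by move=> i /andP[i0 i_n]; apply: h; rewrite i0 ltnW.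
  by rewrite leq_eqVlt => /orP[/eqP -> //|i_n]; apply: h1; rewrite i0.
(* Survival up to n + 1 is survival up to n together with X_(n+1) in the chamber; [hup_on] carries
   the second condition. *)
transitivity (\int[P]_(w in L `&` S n) F (walk xi x n w, block xi n 1 w)).
  rewrite integral_mkcond [RHS]integral_mkcond; apply: eq_integral => w _.
  rewrite !patchE FE -path_walk_shift addn1 -walk_steps /hup_on indicE.
  case: (boolP (w \in L `&` S n)) => [/set_mem[Lw Sw]|nw]; last first.
    rewrite ifF//; apply/negbTE; apply: contra nw; rewrite !inE.
    by move=> [[Lw _] /stayS[]].
  case: (boolP (walk xi x n.+1 w \in B `&` W)) => [/set_mem[Bw Ww]|nBW].
    by rewrite mul1e ifT// inE; split; [split|exact/stayS].
  rewrite mul0e ifF//; apply/negbTE; apply: contra nBW; rewrite !inE.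
  by move=> [[_ Bw] /stayS[]].
have pE : prefix xi n (L `&` S n).
  by apply: prefixI; [exact: past_prefix pL|exact: prefix_stay].
rewrite (walk_markov xi_indep xi_ident x pE mF (fun z => hup_on_ge0 _ _)).
rewrite integral_mkcondr; apply: eq_integral => w _.
rewrite patchE /weight indicE.
case: (boolP (w \in S n)) => [/set_mem Sw|_]; last first.
  by rewrite mul0e mul0e.
have Ww := walk_weyl Sw.
rewrite mul1e up_kernelE /up_weight indicE mem_set// mul1r muleA.
(* h(X_n) is finite and positive because X_n lies in the chamber. *)
rewrite -{1}(fineK (hup_fin_num hup_fin Ww)) -EFinM mulfV ?mul1e; last first.
  by rewrite gt_eqF// (fine_hup_gt0 hup_fin).
by apply: eq_integral => w' _; rewrite FE.
Qed.

Lemma up_chain : exists mu : nat -> {measure set Om -> \bar R},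
  (forall n L, measurable L -> mu n L = Pup xi x (fun=> Some n) L) /\
  killed_markov_chain (walk xi x) mu (up_kernel : R.-spker V ~> V) x.
Proof.
exists mu; split=> [n L _|]; first exact: muE.
by split=> [B|n L B]; [exact: initial|exact: transition].
Qed.

End Chain.

Lemma up_kernel_exists : exists K : R.-spker V ~> V,
  (forall w B, W w -> measurable B -> K w B = trans_up xi w B) /\
  forall x, W x -> exists mu : nat -> {measure set Om -> \bar R},
    (forall n L, measurable L -> mu n L = Pup xi x (fun=> Some n) L) /\
    killed_markov_chain (walk xi x) mu K x.
Proof. by exists up_kernel; split; [exact: up_kernel_trans|exact: up_chain]. Qed.

End DoobTransform.

Theorem theorem1 (R : realType) (d : nat) (hd : (2 <= d)%N)
    (dO : measure_display) (Om : measurableType dO) (P : probability Om R)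
    (xi : nat -> {RV P >-> d.-tuple R})
    (xi_indep : mutually_independent xi)
    (xi_ident : identically_distributed xi)
    (up_down : forall k : 'I_d.-1,
       (0 < P [set w | (0 < tnth (Y xi 1 w) k)%R])%E /\
       (0 < P [set w | (tnth (Y xi 1 w) k < 0)%R])%E)
    (N : R -> {RV P >-> nat})
    (N_geom : forall c : R, 0 < c -> geometric_time P c (N c))
    (N_indep : forall c : R, 0 < c ->
       independent_of P (N c) (past_oo (walk xi (vzero d))))
    (hup_fin : forall x, weyl x -> (hup xi x < +oo)%E) :
  (forall (x : d.-tuple R) (T : Om -> option nat) (L : set Om),
     weyl x ->
     stopping_time (R := R) (past (walk xi x)) T ->
     P [set w | T w = None] = 0%E ->
     stopped_past (R := R) (walk xi x) T L ->
     (cond_prob P (L `&` [set w | (etime (T w) <= ((N c w)%:R)%:E :> \bar R)%E])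
        (stays xi x (N c)))%:E @[c --> (0 : R)^'+] --> Pup xi x T L) /\
  (exists K : R.-spker (d.-tuple R) ~> (d.-tuple R),
     (forall w B, weyl w -> measurable B -> K w B = trans_up xi w B) /\
     forall x, weyl x ->
       exists mu : nat -> {measure set Om -> \bar R},
         (forall n L, measurable L ->
            mu n L = Pup xi x (fun=> Some n) L) /\
         killed_markov_chain (walk xi x) mu K x) /\
  ((\int[P]_w exit_time xi (vzero d) w = +oo)%E ->
     forall x n, weyl x -> (0 < n)%N ->
       Pup xi x (fun=> Some n) setT = 1%E) /\
  ((\int[P]_w exit_time xi (vzero d) w < +oo)%E ->
     forall x n, weyl x -> (0 < n)%N ->
       (Pup xi x (fun=> Some n) setT < 1)%E).
Proof.
split; [|split; [|split]].
- move=> x T L xW _ _ LT.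
  exact: (cond_prob_cvg xi_indep xi_ident xW (hup_fin x xW) N_geom N_indep LT).
- exact: (up_kernel_exists xi_indep xi_ident hup_fin).
- move=> tinf x n xW _.
  exact: (Pup_fixed_eq1 xi_indep xi_ident hup_fin n xW
    (pladder_eq1 xi_indep xi_ident tinf)).
- move=> tfin x n xW n0.
  exact: (Pup_fixed_lt1 xi_indep xi_ident hup_fin xW n0
    (pladder_lt1 xi_indep xi_ident tfin)).
Qed.
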